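(* Let $n\geq 1$. With respect to the semiclassical limit Poisson structure: (i) the subalgebra $\mathbb{C}[\overline{c}_{1},\dots,\overline{c}_{n-1}]$ is a maximal Poisson-commutative subalgebra of $\mathcal{O}(SL_{n})$; (ii) the subalgebra $\mathbb{C}[c_{1},\dots,c_{n}]$ is a maximal Poisson-commutative subalgebra of $\mathcal{O}(M_{n})$; (iii) the subalgebra $\mathbb{C}[c_{1},\dots,c_{n},c_{n}^{-1}]$ is a maximal Poisson-commutative subalgebra of $\mathcal{O}(GL_{n})$.
   Context: All algebras are over $\mathbb{C}$; subalgebras are unital. A commutative Poisson algebra is a unital commutative associative algebra $A$ with a bilinear antisymmetric bracket $\{.,.\}:A\times A\to A$ satisfying the Jacobi identity and such that $\{a,.\}$ is a derivation for every $a\in A$. A subalgebra $C\leq A$ is Poisson-commutative if $\{c,d\}=0$ for all $c,d\in C$; it is maximal Poisson-commutative if it is Poisson-commutative and no Poisson-commutative subalgebra of $A$ strictly contains it. $\mathcal{O}(M_n)=\mathbb{C}[x_{i,j}\mid 1\le i,j\le n]$ is the coordinate ring of $n\times n$ matrices (a polynomial ring in $n^2$ variables), $\det\in\mathcal{O}(M_n)$ is the determinant of the matrix $(x_{i,j})$, $\mathcal{O}(GL_n)=\mathcal{O}(M_n)[\det^{-1}]$ and $\mathcal{O}(SL_n)=\mathcal{O}(M_n)/(\det-1)$. The semiclassical limit Poisson bracket on $\mathcal{O}(M_n)$ is the unique Poisson bracket (extended by bilinearity, antisymmetry and the Leibniz rule) determined on generators by: $\{x_{i,j},x_{k,l}\}=2x_{i,l}x_{k,j}$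 if $i<k$ and $j<l$; $\{x_{i,j},x_{k,l}\}=x_{i,j}x_{k,l}$ if ($i=k$ and $j<l$) or ($j=l$ and $i<k$); and $\{x_{i,j},x_{k,l}\}=0$ if $i<k$ and $j>l$. The element $\det$ is Poisson-central (i.e. $\{\det,a\}=0$ for all $a$), and the semiclassical limit Poisson brackets on $\mathcal{O}(GL_n)$ and $\mathcal{O}(SL_n)$ are the ones induced by localizing at $\det$ and by passing to the quotient by the ideal $(\det-1)$, respectively. For $1\le i\le n$, $c_i\in\mathcal{O}(M_n)$ is the sum of all principal $i\times i$ minors of the matrix $(x_{k,l})$, i.e. the $i$-th coefficient, up to sign, of the characteristic polynomial; in particular $c_1=\sum_i x_{i,i}$ is the trace and $c_n=\det$. The same symbols denote their images in $\mathcal{O}(GL_n)$, and $\overline{c}_i$ denotes the image of $c_i$ in $\mathcal{O}(SL_n)$. *)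

(* Defs.v *)
From HB Require Import structures.
From mathcomp Require Import all_boot all_order all_algebra.
From mathcomp Require Import perm generic_quotient ring_quotient fraction.
From mathcomp Require Import mpoly.
From mathcomp Require Import boolp classical_sets.
From mathcomp Require Import ring zify.

Set Implicit Arguments.
Unset Strict Implicit.
Unset Printing Implicit Defensive.

Import GRing.Theory.
Local Open Scope ring_scope.
Local Open Scope classical_set_scope.

Record poisson_bracket (K : fieldType) (A : comAlgType K) := PoissonBracket {
  pbr :> A -> A -> A;
  pbr_linearl : forall b, linear (pbr^~ b);
  pbr_linearr : forall a, linear (pbr a);
  pbr_anti : forall a b, pbr a b = - pbr b a;
  pbr_jacobi : forall a b c,
    pbr a (pbr b c) + pbr b (pbr c a) + pbr c (pbr a b) = 0;
  pbr_leibniz : forall a b c, pbr a (b * c) = pbr a b * c + b * pbr a c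
}.
Arguments pbr : simpl never.

Section PoissonCommutative.
Variables (K : fieldType) (A : comAlgType K).

Definition subalgebra (S : set A) : Prop := GRing.subalg_closed (mem S).

Definition subalg_gen (X : set A) : set A := smallest subalgebra X.

Definition poisson_commutative (br : poisson_bracket A) (S : set A) : Prop :=
  forall c d, S c -> S d -> br c d = 0.

Definition maximal_poisson_commutative
    (br : poisson_bracket A) (S : set A) : Prop :=
  [/\ subalgebra S, poisson_commutative br S &
      ~ exists T, [/\ subalgebra T, poisson_commutative br T & S `<` T]].

End PoissonCommutative.

(* The n * n variables are indexed through mxvec_index, so that the generic
   matrix xmat is the vec_mx of the row of variables. *)
Notation OM K n := {mpoly K[n * n]}.

Lemma det_mxsub_bij (R : comNzRingType) m p (e : p = m) (f : 'I_m -> 'I_p)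
    (A : 'M[R]_p) : injective f -> \det (mxsub f f A) = \det A.
Proof.
move: f; rewrite -e => f f_inj.
have -> : mxsub f f A = row_perm (perm f_inj) (col_perm (perm f_inj) A).
  by apply/matrixP => i j; rewrite !mxE !permE.
rewrite row_permE col_permE !det_mulmx !det_perm odd_permV.
by rewrite mulrC -mulrA -signr_addb addbb mulr1.
Qed.

Section CoordinateRing.
Variables (K : fieldType) (n : nat).

Definition xM (i j : 'I_n) : OM K n := 'X_(mxvec_index i j).

Definition xmat : 'M[OM K n]_n := \matrix_(i, j) xM i j.

Definition detM : OM K n := \det xmat.

(* Sum of the principal i x i minors; enum_val lists I increasingly. *)
Definition cM (i : nat) : OM K n :=
  \sum_(I : {set 'I_n} | #|I| == i)
    \det (mxsub (@enum_val _ (mem I)) (@enum_val _ (mem I)) xmat).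

Lemma cM_det : cM n = detM.
Proof.
rewrite /cM (big_pred1 (finset.setTfor 'I_n)); last first.
  move=> I; rewrite /= eqEcard finset.subsetT /= cardsT card_ord.
  by rewrite eqn_leq -[X in (_ <= X)%N](card_ord n) max_card.
by rewrite det_mxsub_bij //; [rewrite cardsT card_ord|exact: enum_val_inj].
Qed.

(* sc_half i j k l is {x_ij, x_kl} in the cases i < k, or i = k and j < l, or
   j = l and i < k, and 0 otherwise. Exactly one of (i, j, k, l) and
   (k, l, i, j) falls in these cases when (i, j) != (k, l), so sc_gen is the
   antisymmetric extension to all pairs of generators. *)
Definition sc_half (i j k l : 'I_n) : OM K n :=
  if (i < k)%N && (j < l)%N then 2%:R * (xM i l * xM k j)
  else if (i == k) && (j < l)%N || (j == l) && (i < k)%N then xM i j * xM k l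
  else 0.

Definition sc_gen (i j k l : 'I_n) : OM K n :=
  sc_half i j k l - sc_half k l i j.

(* The only biderivation with the values sc_gen on the generators. *)
Definition sc_op (f g : OM K n) : OM K n :=
  \sum_(a : 'I_n * 'I_n) \sum_(b : 'I_n * 'I_n)
    sc_gen a.1 a.2 b.1 b.2 *
      (f^`M(mxvec_index a.1 a.2) * g^`M(mxvec_index b.1 b.2)).

Let sg (i k : 'I_n) : K := (i < k)%N%:R - (k < i)%N%:R.

Lemma sgxx i : sg i i = 0.
Proof. by rewrite /sg ltnn subrr. Qed.

Lemma sc_genE i j k l : sc_gen i j k l = (sg i k + sg j l) *: (xM i l * xM k j).
Proof.
rewrite /sc_gen /sc_half /sg.
rewrite -!(inj_eq val_inj) -mul_mpolyC raddfD /= !raddfB /=.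
case: (ltngtP i k) => [ik|ik|/val_inj <-]; case: (ltngtP j l) => [jl|jl|/val_inj <-];
 rewrite /= ?mpolyC1 ?mpolyC0; ring.
Qed.


Lemma sc_op_anti f g : sc_op f g = - sc_op g f.
Proof.
rewrite /sc_op exchange_big /= -sumrN; apply: eq_bigr => a _.
rewrite -sumrN; apply: eq_bigr => b _; rewrite /sc_gen; ring.
Qed.

Lemma sc_op_linearr f : linear (sc_op f).
Proof.
move=> c g h; rewrite /sc_op scaler_sumr -big_split; apply: eq_bigr => a _ /=.
rewrite scaler_sumr -big_split; apply: eq_bigr => b _ /=.
by rewrite mderivD mderivZ !mulrDr -!scalerAr.
Qed.

Lemma sc_op_linearl g : linear (sc_op^~ g).
Proof.
move=> c f h /=.
by rewrite sc_op_anti sc_op_linearr opprD -scalerN -!(sc_op_anti _ g).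
Qed.

Lemma sc_op_leibniz f g h : sc_op f (g * h) = sc_op f g * h + g * sc_op f h.
Proof.
rewrite /sc_op mulr_suml mulr_sumr -big_split; apply: eq_bigr => a _ /=.
rewrite mulr_suml mulr_sumr -big_split; apply: eq_bigr => b _ /=.
rewrite mderivM; ring.
Qed.

Lemma mderiv_var i j (a : 'I_n * 'I_n) :
  (xM i j)^`M(mxvec_index a.1 a.2) = ((i, j) == a)%:R.
Proof.
rewrite /xM mderivX mnm1E.
have -> : (mxvec_index i j == mxvec_index a.1 a.2) = ((i, j) == a).
  case: a => k l; apply/eqP/eqP => /= [|[-> ->] //].
  by move=> /cast_ord_inj/enum_rank_inj.
case: eqP => [<-|_] /=; last by rewrite scale0r.
by rewrite scale1r -{1}[U_(_)%MM]add0m addmK mpolyX0.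
Qed.

Lemma sc_op_var i j k l : sc_op (xM i j) (xM k l) = sc_gen i j k l.
Proof.
rewrite /sc_op (bigD1 (i, j)) //= [X in _ + X]big1 ?addr0; last first.
  move=> a /negPf neq; rewrite big1 // => b _.
  by rewrite mderiv_var eq_sym neq mul0r mulr0.
rewrite (bigD1 (k, l)) //= [X in _ + X]big1 ?addr0; last first.
  move=> b /negPf neq.
  by rewrite !mderiv_var [_ == b]eq_sym neq !mulr0.
by rewrite (mderiv_var i j (i, j)) (mderiv_var k l (k, l)) !eqxx !mulr1.
Qed.

Lemma derivation_eq0 (D : OM K n -> OM K n) :
    linear D -> (forall f g, D (f * g) = D f * g + f * D g) ->
    (forall i j, D (xM i j) = 0) ->
  forall f, D f = 0.
Proof.
move=> lD mD xD.
have D0 : D 0 = 0 by have := lD (-1) 0 0; rewrite scaler0 addr0 scaleN1r addNr.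
have D1 : D 1 = 0.
  have := mD 1 1; rewrite !mulr1 mul1r => /esym/eqP.
  by rewrite -subr_eq0 addrK => /eqP.
elim/mpolyind => // c m p _ _ Dp; rewrite lD Dp addr0.
rewrite mpolyXE_id (big_ind (fun q => D q = 0)) ?scaler0 //.
  by move=> f g Df Dg; rewrite mD Df Dg mul0r mulr0 addr0.
move=> a _; have [i j] := mxvec_indexP a.
elim: (m _) => [|k IH]; first by rewrite expr0.
by rewrite exprS mD IH xD mul0r mulr0 addr0.
Qed.

Lemma mderiv_cofactor i j k :
  (cofactor xmat i j)^`M(mxvec_index i k) = 0.
Proof.
set a := mxvec_index i k.
have d1 : (1 : OM K n)^`M(a) = 0 by rewrite -mpolyC1 mderivC.
have derM0 f g : f^`M(a) = 0 -> g^`M(a) = 0 -> (f * g)^`M(a) = 0.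
  by move=> df dg; rewrite mderivM df dg mul0r mulr0 addr0.
have dS c : ((-1) ^+ c : OM K n)^`M(a) = 0.
  elim: c => [//|c IH]; rewrite exprS; apply: (derM0) => //.
  by rewrite mderivN d1 oppr0.
apply: (derM0) => //; rewrite raddf_sum big1 // => s _; apply: (derM0) => //.
apply: (big_ind (fun q : OM K n => q^`M(a) = 0)) => [|f g|l _]; [exact: d1|exact: derM0|].
rewrite !mxE (mderiv_var _ _ (i, k)) -pair_eqE /=.
by rewrite eq_sym (negPf (neq_lift _ _)).
Qed.

Lemma mderiv_det (a : 'I_n * 'I_n) :
  detM^`M(mxvec_index a.1 a.2) = cofactor xmat a.1 a.2.
Proof.
case: a => i j /=; rewrite /detM (expand_det_row _ i) raddf_sum (bigD1 j) //=.
rewrite big1 ?addr0 => [|l /negPf neq]; rewrite mderivM mderiv_cofactor mulr0 addr0.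
  by rewrite mxE (mderiv_var i j (i, j)) eqxx mul1r.
by rewrite mxE (mderiv_var i l (i, j)) -pair_eqE /= neq andbF mul0r.
Qed.

Lemma detM_central f : sc_op detM f = 0.
Proof.
apply: derivation_eq0 f => [||k l]; [exact: sc_op_linearr| exact: sc_op_leibniz|].
rewrite sc_op_anti; apply/eqP; rewrite oppr_eq0; apply/eqP.
rewrite /sc_op (bigD1 (k, l)) //= [X in _ + X]big1 ?addr0; last first.
  move=> a /negPf neq; rewrite big1 // => b _.
  by rewrite mderiv_var eq_sym neq mul0r mulr0.
transitivity (
    \sum_i \sum_j sg k i *: (xM k j * xM i l) * cofactor xmat i j +
    \sum_j \sum_i sg l j *: (xM k j * xM i l) * cofactor xmat i j).
  rewrite [X in _ + X]exchange_big !pair_bigA -big_split; apply: eq_bigr => b _.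
  rewrite /= (mderiv_var k l (k, l)) eqxx mul1r mderiv_det sc_genE.
  by rewrite scalerDl mulrDl.
have rowE i : \sum_j xM k j * cofactor xmat i j = detM *+ (k == i).
  have /matrixP/(_ k i) := mul_mx_adj xmat; rewrite !mxE => <-.
  by apply: eq_bigr => j _; rewrite !mxE.
have colE j : \sum_i xM i l * cofactor xmat i j = detM *+ (j == l).
  have /matrixP/(_ j l) := mul_adj_mx xmat; rewrite !mxE => <-.
  by apply: eq_bigr => i _; rewrite !mxE mulrC.
rewrite [X in X + _]big1 ?add0r => [|i _]; last first.
  transitivity (sg k i *: (xM i l * \sum_j xM k j * cofactor xmat i j)).
    rewrite mulr_sumr scaler_sumr; apply: eq_bigr => j _.
    by rewrite -scalerAl mulrA [xM k j * _]mulrC.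
  rewrite rowE; case: eqP => [->|_]; first by rewrite sgxx scale0r.
  by rewrite mulr0n mulr0 scaler0.
rewrite big1 // => j _.
transitivity (sg l j *: (xM k j * \sum_i xM i l * cofactor xmat i j)).
  rewrite mulr_sumr scaler_sumr; apply: eq_bigr => i _.
  by rewrite -scalerAl mulrA.
rewrite colE; case: eqP => [->|_]; first by rewrite sgxx scale0r.
by rewrite mulr0n mulr0 scaler0.
Qed.

Lemma sg_cyc i k m : sg i k * sg k m + sg k m * sg m i + sg m i * sg i k =
  - (~~ ((i == k) && (k == m)))%:R.
Proof.
rewrite /sg -!(inj_eq val_inj) /=.
case: (ltngtP i k) => [ik|ik|ik]; case: (ltngtP k m) => [km|km|km];
  case: (ltngtP m i) => [mi|mi|mi]; rewrite /=; try (by exfalso; lia); ring.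
Qed.

Lemma sgC i k : sg i k = - sg k i.
Proof. by rewrite /sg opprB. Qed.

Lemma jacobi_ext (br : OM K n -> OM K n -> OM K n) :
    (forall b, linear (br^~ b)) -> (forall a, linear (br a)) ->
    (forall a b, br a b = - br b a) ->
    (forall a b c, br a (b * c) = br a b * c + b * br a c) ->
    (forall i j k l m p,
      br (xM i j) (br (xM k l) (xM m p)) + br (xM k l) (br (xM m p) (xM i j)) +
        br (xM m p) (br (xM i j) (xM k l)) = 0) ->
  forall f g h, br f (br g h) + br g (br h f) + br h (br f g) = 0.
Proof.
move=> brl brr brA brM JX.
pose J a b c := br a (br b c) + br b (br c a) + br c (br a b).
have JC a b c : J a b c = J b c a by rewrite /J -addrA addrC.
have JD a b : linear (J a b).
  move=> c p q; rewrite /J !brr !brl !brr -!mul_mpolyC; ring.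
have brDr a b c : br a (b + c) = br a b + br a c.
  by rewrite -{1}[b]scale1r brr scale1r.
have brMl a b c : br (b * c) a = br b a * c + b * br c a.
  rewrite brA brM (brA a b) (brA a c); ring.
have JM a b : forall p q, J a b (p * q) = J a b p * q + p * J a b q.
  move=> p q; rewrite /J !(brMl, brM, brDr) (brA p a) (brA q a); ring.
have J1 i j k l a : J (xM i j) (xM k l) a = 0.
  by apply: (derivation_eq0 (JD _ _) (JM _ _)) => m p; rewrite /J JX.
have J2 i j a b : J (xM i j) a b = 0.
  by apply: (derivation_eq0 (JD _ _) (JM _ _)) => k l; rewrite -JC J1.
move=> f g h; rewrite -/(J f g h).
by apply: (derivation_eq0 (JD _ _) (JM _ _)) => i j; rewrite -JC J2.
Qed.

Lemma sc_jacobi f g h :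
  sc_op f (sc_op g h) + sc_op g (sc_op h f) + sc_op h (sc_op f g) = 0.
Proof.
apply: jacobi_ext f g h;
  [exact: sc_op_linearl|exact: sc_op_linearr|exact: sc_op_anti
  |exact: sc_op_leibniz|move=> i j k l m p].
have opZr c a b : sc_op a (c *: b) = c *: sc_op a b.
  have op0 : sc_op a 0 = 0.
    have := sc_op_linearr a 1 0 0; rewrite scaler0 addr0 scale1r => /eqP.
    by rewrite -subr_eq0 opprD addNKr oppr_eq0 => /eqP.
  by rewrite -[c *: b]addr0 sc_op_linearr op0 addr0.
transitivity (
  ((sg i k * sg k m + sg k m * sg m i + sg m i * sg i k) -
   (sg j l * sg l p + sg l p * sg p j + sg p j * sg j l))%:MP *
  (xM i p * xM k j * xM m l - xM k p * xM i l * xM m j)).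
  rewrite !sc_op_var !sc_genE !opZr !sc_op_leibniz !sc_op_var !sc_genE.
  rewrite (sgC i m) (sgC k i) (sgC m k) (sgC j p) (sgC l j) (sgC p l).
  rewrite -!mul_mpolyC; ring.
rewrite !sg_cyc.
case: (i =P k) => [->|_]; case: (k =P m) => [->|_];
  case: (j =P l) => [->|_]; case: (l =P p) => [->|_];
  rewrite /= ?subrr ?mpolyC0 ?mul0r //; ring.
Qed.

Definition sc_bracket : poisson_bracket (OM K n) :=
  PoissonBracket sc_op_linearl sc_op_linearr sc_op_anti sc_jacobi sc_op_leibniz.

End CoordinateRing.

Section PoissonTheory.
Variables (K : fieldType) (A : comAlgType K) (br : poisson_bracket A).

Lemma pbrDr a b c : br a (b + c) = br a b + br a c.
Proof. by have := pbr_linearr br a 1 b c; rewrite !scale1r. Qed.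

Lemma pbrDl a b c : br (b + c) a = br b a + br c a.
Proof. by have := pbr_linearl br a 1 b c; rewrite /= !scale1r. Qed.

Lemma pbr0r a : br a 0 = 0.
Proof. by apply: (addrI (br a 0)); rewrite -pbrDr !addr0. Qed.

Lemma pbrZr k a b : br a (k *: b) = k *: br a b.
Proof. by have := pbr_linearr br a k b 0; rewrite pbr0r !addr0. Qed.

Lemma pbr0l a : br 0 a = 0.
Proof. by rewrite pbr_anti pbr0r oppr0. Qed.

Lemma pbrZl k a b : br (k *: b) a = k *: br b a.
Proof. by rewrite pbr_anti pbrZr -scalerN -pbr_anti. Qed.

Lemma pbrNr a b : br a (- b) = - br a b.
Proof. by rewrite -scaleN1r pbrZr scaleN1r. Qed.

Lemma pbr1r a : br a 1 = 0.
Proof.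
by apply: (addrI (br a 1)); rewrite addr0 -[RHS](mulr1 (br a 1)) -[in RHS](mulr1 1)
   -{1}[br a 1]mulr1 -{2}[br a 1]mul1r -pbr_leibniz !mulr1.
Qed.

Lemma pbrX_central d k a : (forall b, br b d = 0) -> br a (d ^+ k) = 0.
Proof.
move=> dC; elim: k => [|k IH]; first by rewrite expr0 pbr1r.
by rewrite exprS pbr_leibniz IH dC mul0r mulr0 addr0.
Qed.

Lemma pbrMX_central d k a b :
  (forall b, br b d = 0) -> br a (b * d ^+ k) = br a b * d ^+ k.
Proof. by move=> dC; rewrite pbr_leibniz pbrX_central // mulr0 addr0. Qed.
End PoissonTheory.

Section SL.
Variables (K : fieldType) (n : nat).
Local Notation br := (sc_bracket K n).
Local Notation detM := (detM K n).

Lemma sc_bracket_det f : br f detM = 0.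
Proof. by rewrite pbr_anti [br _ _]detM_central oppr0. Qed.

Definition SL_ideal : {pred OM K n} :=
  fun f => `[< exists g, f = g * (detM - 1) >].

Lemma SL_ideal_closed : idealr_closed SL_ideal.
Proof.
split; first by apply/asboolP; exists 0; rewrite mul0r.
  apply/negP => /asboolP[g /(congr1 (meval (fun a => mxvec 1%:M 0 a)))].
  rewrite rmorphM rmorphB /= !rmorph1 -det_map_mx.
  set B := map_mx _ _; have -> : B = 1%:M.
    by apply/matrixP => i j; rewrite /B 2!mxE /= /xM mevalXU mxvecE.
  by rewrite det1 subrr mulr0 => /eqP; rewrite oner_eq0.
move=> a u v /asboolP[g ->] /asboolP[h ->]; apply/asboolP.
by exists (a * g + h); rewrite mulrDl mulrA.
Qed.

HB.instance Definition _ := isIdealr.Build (OM K n) SL_ideal SL_ideal_closed.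

Definition OSL := {ideal_quot SL_ideal}.
HB.instance Definition _ := GRing.ComNzRing.on OSL.

Definition toSL (f : OM K n) : OSL := \pi_({ideal_quot SL_ideal})%qT f.

Lemma toSL_is_zmod_morphism : zmod_morphism toSL.
Proof. by move=> f g; rewrite /toSL rmorphB. Qed.
Lemma toSL_is_monoid_morphism : monoid_morphism toSL.
Proof. by split=> [|f g]; rewrite /toSL ?rmorph1 ?rmorphM. Qed.
HB.instance Definition _ :=
  GRing.isZmodMorphism.Build (OM K n) OSL toSL toSL_is_zmod_morphism.
HB.instance Definition _ :=
  GRing.isMonoidMorphism.Build (OM K n) OSL toSL toSL_is_monoid_morphism.

Definition SL_scale (c : K) (a : OSL) : OSL := toSL c%:MP * a.
Lemma SL_scaleA a b v : SL_scale a (SL_scale b v) = SL_scale (a * b) v.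
Proof. by rewrite /SL_scale !rmorphM mulrA. Qed.
Lemma SL_scale1 : left_id 1 SL_scale.
Proof. by move=> v; rewrite /SL_scale !rmorph1 mul1r. Qed.
Lemma SL_scaleDr : right_distributive SL_scale +%R.
Proof. by move=> a u v; rewrite /SL_scale mulrDr. Qed.
Lemma SL_scaleDl v : {morph SL_scale^~ v : a b / a + b}.
Proof. by move=> a b; rewrite /SL_scale !rmorphD mulrDl. Qed.
HB.instance Definition _ := GRing.Zmodule_isLmodule.Build K OSL
  SL_scaleA SL_scale1 SL_scaleDr SL_scaleDl.
Lemma SL_scaleAl (a : K) (u v : OSL) : a *: (u * v) = (a *: u) * v.
Proof. exact: mulrA. Qed.
HB.instance Definition _ := GRing.Lmodule_isLalgebra.Build K OSL SL_scaleAl.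
HB.instance Definition _ := GRing.Lalgebra_isComAlgebra.Build K OSL.

Lemma toSLZ c f : toSL (c *: f) = c *: toSL f.
Proof. by rewrite -mul_mpolyC rmorphM. Qed.

Lemma toSL_surj a : exists f, a = toSL f.
Proof. by exists (repr a); rewrite /toSL reprK. Qed.

Lemma toSL_eqP f g : toSL f = toSL g <-> exists h, f = g + h * (detM - 1).
Proof.
split=> [/eqP|[h ->]].
  rewrite /toSL -Quotient.idealrBE => /asboolP[h] /eqP.
  by rewrite subr_eq addrC => /eqP ->; exists h.
apply/eqP; rewrite /toSL -Quotient.idealrBE; apply/asboolP; exists h.
by rewrite addrAC subrr add0r.
Qed.

(* Independent of the representatives, see SL_op_toSL: {det, -} = 0. *)
Definition SL_op (a b : OSL) : OSL := toSL (br (repr a) (repr b)).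

Lemma SL_op_toSL f g : SL_op (toSL f) (toSL g) = toSL (br f g).
Proof.
have compat f1 f2 h : toSL f1 = toSL f2 -> toSL (br h f1) = toSL (br h f2).
  move=> /toSL_eqP[u ->]; apply/toSL_eqP; exists (br h u).
  by rewrite pbrDr pbr_leibniz pbrDr pbrNr pbr1r sc_bracket_det subrr mulr0 addr0.
have reprE h : toSL (repr (toSL h)) = toSL h by rewrite /toSL reprK.
rewrite /SL_op (compat _ g _ (reprE g)) pbr_anti rmorphN /=.
by rewrite (compat _ f _ (reprE f)) (pbr_anti br f g) rmorphN.
Qed.

Lemma SL_op_linearr a : linear (SL_op a).
Proof.
have [f ->] := toSL_surj a; move=> c u v.
have [g ->] := toSL_surj u; have [h ->] := toSL_surj v.
by rewrite -toSLZ -rmorphD !SL_op_toSL pbr_linearr rmorphD /= toSLZ.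
Qed.
Lemma SL_op_anti a b : SL_op a b = - SL_op b a.
Proof.
have [f ->] := toSL_surj a; have [g ->] := toSL_surj b.
by rewrite !SL_op_toSL pbr_anti rmorphN.
Qed.
Lemma SL_op_linearl b : linear (SL_op^~ b).
Proof.
move=> c u v /=.
by rewrite SL_op_anti SL_op_linearr opprD -scalerN -!(SL_op_anti _ b).
Qed.
Lemma SL_op_jacobi a b c :
  SL_op a (SL_op b c) + SL_op b (SL_op c a) + SL_op c (SL_op a b) = 0.
Proof.
have [f ->] := toSL_surj a; have [g ->] := toSL_surj b.
have [h ->] := toSL_surj c.
by rewrite !SL_op_toSL -!rmorphD pbr_jacobi rmorph0.
Qed.
Lemma SL_op_leibniz a b c : SL_op a (b * c) = SL_op a b * c + b * SL_op a c.
Proof.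
have [f ->] := toSL_surj a; have [g ->] := toSL_surj b.
have [h ->] := toSL_surj c.
by rewrite -rmorphM !SL_op_toSL pbr_leibniz rmorphD !rmorphM.
Qed.

Definition SL_bracket : poisson_bracket OSL :=
  PoissonBracket SL_op_linearl SL_op_linearr SL_op_anti SL_op_jacobi
    SL_op_leibniz.

Lemma SL_bracket_toSL f g : SL_bracket (toSL f) (toSL g) = toSL (br f g).
Proof. exact: SL_op_toSL. Qed.

End SL.

Section GL.
Variables (K : fieldType) (n : nat).
Local Notation br := (sc_bracket K n).
Local Notation detM := (detM K n).

Local Notation "x %:F" := (@FracField.tofrac (OM K n) x).

(* O(GL_n) is realized inside the fraction field of the domain O(M_n). *)
Definition GL_pred : {pred {fraction OM K n}} :=
  fun x => `[< exists (f : OM K n) (k : nat), x = f%:F / detM%:F ^+ k >].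

Lemma detM_neq0 : detM != 0.
Proof.
apply/eqP => d0; have := SL_ideal_closed K n; case=> _ /negP[]; apply/asboolP.
by exists (-1); rewrite d0 sub0r mulrNN mulr1.
Qed.

Lemma detF_neq0 k : detM%:F ^+ k != 0.
Proof. by rewrite expf_neq0 // tofrac_eq0 detM_neq0. Qed.

Lemma fracD (f g : OM K n) k l : f%:F / detM%:F ^+ k + g%:F / detM%:F ^+ l =
  (f * detM ^+ l + g * detM ^+ k)%:F / detM%:F ^+ (k + l).
Proof.
by rewrite addf_div ?detF_neq0 // rmorphD !rmorphM /= !rmorphXn /= exprD.
Qed.

Lemma fracM (f g : OM K n) k l : (f%:F / detM%:F ^+ k) * (g%:F / detM%:F ^+ l) =
  (f * g)%:F / detM%:F ^+ (k + l).
Proof. by rewrite rmorphM exprD invfM mulrACA. Qed.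

Lemma frac_eq (f g : OM K n) k l : f * detM ^+ l = g * detM ^+ k <->
  f%:F / detM%:F ^+ k = g%:F / detM%:F ^+ l.
Proof.
split=> [e|/eqP].
  apply/eqP; rewrite eqr_div ?detF_neq0 // -!rmorphXn -!rmorphM /=.
  by rewrite e.
rewrite eqr_div ?detF_neq0 // -!rmorphXn -!rmorphM /= tofrac_eq.
by move/eqP.
Qed.

Lemma GL_subring : subring_closed GL_pred.
Proof.
split.
- by apply/asboolP; exists 1, 0%N; rewrite rmorph1 expr0 divr1.
- move=> x y /asboolP[f [k ->]] /asboolP[g [l ->]]; apply/asboolP.
  by rewrite -mulNr -rmorphN fracD; do 2 eexists.
- move=> x y /asboolP[f [k ->]] /asboolP[g [l ->]]; apply/asboolP.
  by rewrite fracM; do 2 eexists.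
Qed.
HB.instance Definition _ :=
  GRing.isSubringClosed.Build {fraction OM K n} GL_pred GL_subring.

Record OGL := MkOGL { GL_val : {fraction OM K n}; _ : GL_val \in GL_pred }.
HB.instance Definition _ := [isSub for GL_val].
HB.instance Definition _ := [Choice of OGL by <:].
HB.instance Definition _ := [SubChoice_isSubComNzRing of OGL by <:].

Lemma frac_in f k : f%:F / detM%:F ^+ k \in GL_pred.
Proof. by apply/asboolP; exists f, k. Qed.

Definition GL_frac f k : OGL := MkOGL (frac_in f k).

Definition toGL f : OGL := GL_frac f 0.

Lemma GL_valM (x y : OGL) : val (x * y) = val x * val y.
Proof. exact: rmorphM. Qed.

Lemma GL_val1 : val (1 : OGL) = 1.
Proof. exact: rmorph1. Qed.

Lemma val_toGL f : val (toGL f) = f%:F.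
Proof. by rewrite /= expr0 divr1. Qed.

Lemma toGL_is_zmod_morphism : zmod_morphism toGL.
Proof.
by move=> f g; apply: val_inj; rewrite rmorphB /= !expr0 !divr1 rmorphB.
Qed.
Lemma toGL_is_monoid_morphism : monoid_morphism toGL.
Proof.
split=> [|f g]; apply: val_inj.
  by rewrite val_toGL !rmorph1.
by rewrite GL_valM !val_toGL tofracM.
Qed.
HB.instance Definition _ :=
  GRing.isZmodMorphism.Build (OM K n) OGL toGL toGL_is_zmod_morphism.
HB.instance Definition _ :=
  GRing.isMonoidMorphism.Build (OM K n) OGL toGL toGL_is_monoid_morphism.

(* Inversion follows the unitRingType convention: identity off the units. *)
Definition GL_unit : {pred OGL} := fun x => `[< exists y, y * x = 1 >].
Definition GL_inv (x : OGL) : OGL := insubd x (val x)^-1.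

Lemma GL_mulVx : {in GL_unit, left_inverse 1 GL_inv *%R}.
Proof.
move=> x /asboolP[y yx].
have vx : (val x)^-1 = val y.
  have e : val y * val x = 1 by rewrite -rmorphM yx rmorph1.
  have x0 : val x != 0.
    by apply/eqP => x0; move/eqP: e; rewrite x0 mulr0 eq_sym oner_eq0.
  by apply: (mulIf x0); rewrite e mulVf.
by rewrite -yx; congr (_ * _); apply: val_inj; rewrite /GL_inv vx valKd.
Qed.
Lemma GL_unitPl (x y : OGL) : y * x = 1 -> GL_unit x.
Proof. by move=> yx; apply/asboolP; exists y. Qed.
Lemma GL_inv_out : {in [predC GL_unit], GL_inv =1 id}.
Proof.
move=> x /negP xU; apply: val_inj; rewrite val_insubd; case: ifP => // xV.
have [x0|x0] := eqVneq (val x) 0; first by rewrite x0 invr0.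
case: xU; apply: (@GL_unitPl x (MkOGL xV)); apply: val_inj.
by rewrite rmorphM rmorph1 /= mulVf.
Qed.
HB.instance Definition _ :=
  GRing.ComNzRing_hasMulInverse.Build OGL GL_mulVx GL_unitPl GL_inv_out.

Lemma toGL_det_unit : toGL detM \is a GRing.unit.
Proof.
apply/unitrPr; exists (GL_frac 1 1); apply: val_inj.
rewrite GL_valM GL_val1 val_toGL /= tofrac1 expr1 div1r divff //.
by rewrite tofrac_eq0 detM_neq0.
Qed.

Definition GL_scale (c : K) (a : OGL) : OGL := toGL c%:MP * a.
Lemma GL_scaleA a b v : GL_scale a (GL_scale b v) = GL_scale (a * b) v.
Proof. by rewrite /GL_scale !rmorphM mulrA. Qed.
Lemma GL_scale1 : left_id 1 GL_scale.
Proof. by move=> v; rewrite /GL_scale !rmorph1 mul1r. Qed.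
Lemma GL_scaleDr : right_distributive GL_scale +%R.
Proof. by move=> a u v; rewrite /GL_scale mulrDr. Qed.
Lemma GL_scaleDl v : {morph GL_scale^~ v : a b / a + b}.
Proof. by move=> a b; rewrite /GL_scale !rmorphD mulrDl. Qed.
HB.instance Definition _ := GRing.Zmodule_isLmodule.Build K OGL
  GL_scaleA GL_scale1 GL_scaleDr GL_scaleDl.
Lemma GL_scaleAl (a : K) (u v : OGL) : a *: (u * v) = (a *: u) * v.
Proof. exact: mulrA. Qed.
HB.instance Definition _ := GRing.Lmodule_isLalgebra.Build K OGL GL_scaleAl.
HB.instance Definition _ := GRing.Lalgebra_isComAlgebra.Build K OGL.

Lemma GL_fracP (x : OGL) : exists fk, x = GL_frac fk.1 fk.2.
Proof.
by have /asboolP[f [k e]] := valP x; exists (f, k); apply: val_inj.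
Qed.

Lemma GL_frac_eq f g k l :
  GL_frac f k = GL_frac g l <-> f * detM ^+ l = g * detM ^+ k.
Proof.
by split=> [/(congr1 val)/frac_eq|/frac_eq e] //; apply: val_inj.
Qed.

Lemma GL_fracD f g k l : GL_frac f k + GL_frac g l =
  GL_frac (f * detM ^+ l + g * detM ^+ k) (k + l).
Proof. by apply: val_inj; rewrite rmorphD /= fracD. Qed.

Lemma GL_fracM f g k l : GL_frac f k * GL_frac g l = GL_frac (f * g) (k + l).
Proof. by apply: val_inj; rewrite rmorphM /= fracM. Qed.

Lemma GL_fracZ c f k : c *: GL_frac f k = GL_frac (c *: f) k.
Proof. by rewrite [LHS]GL_fracM mul_mpolyC. Qed.

Lemma GL_fracN f k : - GL_frac f k = GL_frac (- f) k.
Proof. by rewrite -scaleN1r GL_fracZ scaleN1r. Qed.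

Definition GL_rep (x : OGL) : OM K n * nat := projT1 (cid (GL_fracP x)).

Lemma GL_repK x : GL_frac (GL_rep x).1 (GL_rep x).2 = x.
Proof. by rewrite /GL_rep; case: (cid _) => fk /= ->. Qed.

(* Since det is Poisson-central, localization forces
   {f / det^k, g / det^l} = {f, g} / det^(k + l); see GL_op_frac. *)
Definition GL_op (x y : OGL) : OGL :=
  GL_frac (br (GL_rep x).1 (GL_rep y).1) ((GL_rep x).2 + (GL_rep y).2).

Lemma GL_op_frac f g k l :
  GL_op (GL_frac f k) (GL_frac g l) = GL_frac (br f g) (k + l).
Proof.
have compat f1 f2 k1 k2 g1 m : GL_frac f1 k1 = GL_frac f2 k2 ->
    GL_frac (br g1 f1) (m + k1) = GL_frac (br g1 f2) (m + k2).
  move=> /GL_frac_eq e; apply/GL_frac_eq; rewrite !exprD.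
  rewrite mulrCA [RHS]mulrCA -!pbrMX_central ?e //; exact: sc_bracket_det.
rewrite /GL_op (compat _ g _ l) ?GL_repK //.
rewrite pbr_anti -GL_fracN addnC (compat _ f _ k) ?GL_repK //.
by rewrite GL_fracN -pbr_anti addnC.
Qed.

Lemma GL_op_anti x y : GL_op x y = - GL_op y x.
Proof.
have [[f k] ->] := GL_fracP x; have [[g l] ->] := GL_fracP y.
by rewrite !GL_op_frac GL_fracN -pbr_anti addnC.
Qed.
Lemma GL_op_linearr x : linear (GL_op x).
Proof.
have [[f k] ->] := GL_fracP x; move=> c y z.
have [[g l] ->] := GL_fracP y; have [[h m] ->] := GL_fracP z.
rewrite /= GL_fracZ GL_fracD !GL_op_frac pbrDr !pbrMX_central;
  try exact: sc_bracket_det.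
rewrite pbrZr GL_fracZ GL_fracD; apply/GL_frac_eq; rewrite !exprD; ring.
Qed.
Lemma GL_op_linearl y : linear (GL_op^~ y).
Proof.
move=> c u v /=.
by rewrite GL_op_anti GL_op_linearr opprD -scalerN -!(GL_op_anti _ y).
Qed.
Lemma GL_op_jacobi x y z :
  GL_op x (GL_op y z) + GL_op y (GL_op z x) + GL_op z (GL_op x y) = 0.
Proof.
have [[f k] ->] := GL_fracP x; have [[g l] ->] := GL_fracP y.
have [[h m] ->] := GL_fracP z.
rewrite !GL_op_frac !GL_fracD -(rmorph0 toGL); apply/GL_frac_eq.
rewrite /= expr0 mulr1 mul0r.
transitivity ((br f (br g h) + br g (br h f) + br h (br f g)) *
  (detM ^+ k * detM ^+ l * detM ^+ m) ^+ 2); last by rewrite pbr_jacobi mul0r.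
move: (br f _) (br g _) (br h _) => u v w; rewrite !exprD.
move: (detM ^+ k) (detM ^+ l) (detM ^+ m) => a b c; ring.
Qed.
Lemma GL_op_leibniz x y z : GL_op x (y * z) = GL_op x y * z + y * GL_op x z.
Proof.
have [[f k] ->] := GL_fracP x; have [[g l] ->] := GL_fracP y.
have [[h m] ->] := GL_fracP z.
rewrite /= !(GL_fracM, GL_op_frac) GL_fracD; apply/GL_frac_eq.
rewrite pbr_leibniz !exprD; ring.
Qed.

Definition GL_bracket : poisson_bracket OGL :=
  PoissonBracket GL_op_linearl GL_op_linearr GL_op_anti GL_op_jacobi
    GL_op_leibniz.

Lemma GL_bracket_toGL f g : GL_bracket (toGL f) (toGL g) = toGL (br f g).
Proof. exact: GL_op_frac. Qed.

End GL.

(* Main.v *)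
Require Import Defs.
From mathcomp Require Import all_boot all_order all_algebra.
From mathcomp Require Import mpoly.
From mathcomp Require Import boolp classical_sets.
From mathcomp Require Import reals complex.
From mathcomp Require Import perm ring zify.
Import GRing.Theory.
Local Open Scope classical_set_scope.
Local Open Scope ring_scope.

Set Implicit Arguments.
Unset Strict Implicit.
Unset Printing Implicit Defensive.

(** Let delta = {c_1, .} be the Hamiltonian derivation of the trace on O(M_n).
    The three claims all follow from one computation: the kernel of delta is
    C[c_1, ..., c_n], and it is Poisson-commutative. Indeed, any
    Poisson-commutative T containing c_1 lies in that kernel.

    Every c_k lies in the kernel. On the generic matrix X the flow has the Lax
    form delta X = [X, P], where P is the strictly upper part of X minus its
    strictly lower part (trace_flow_lax). Hence det (1 + l X) is constant along
    the flow for every scalar l, and its coefficients in l are the c_k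
    (trace_flow_cM).

    An element of the kernel is determined by its restriction to the diagonal
    matrices (trace_flow_injective). The derivation vanishes there, and at
    diag (0, -1, ..., 1 - n) its linear part is the semisimple field
    sum |i - j| x_ij d/dx_ij. The flow is thus expanding in every off-diagonal
    direction: in the Taylor expansion at this point, the terms of lowest degree
    of an invariant cannot involve an off-diagonal variable.

    That restriction is a symmetric polynomial (diag_restr_sym). For p < q the
    flow is tangent to the matrices that are diagonal outside of the rows and
    columns p, q. In the 2 x 2 block a, b, c, d it preserves a + d, a d - b c
    and b / c, and on the conic that these constants cut out when b = - c it
    joins diag (a, d) to diag (d, a). In suitable linear coordinates Z, W on the
    blocks with a given trace and b = - c, the flow is a multiple of the Euler
    field Z d/dZ - W d/dW, whose invariants are the polynomials in Z W
    (trace_flow_euler, euler2_kernel).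

    Since c_k restricts to the k-th elementary symmetric polynomial, the
    fundamental theorem on symmetric polynomials gives for each f in the kernel a
    polynomial in the c_k with the same restriction, hence equal to f
    (trace_flow0_gen). The bracket of two elements of the kernel is in the kernel
    by the Jacobi identity and vanishes on the diagonal, so it is zero
    (trace_flow0_commute).

    For O(GL_n) one clears denominators, det being central. For O(SL_n), a lift F
    of an element commuting with c_1 satisfies delta F = H (det - 1), and
    comparing homogeneous components shows that H = delta G for some G
    (trace_flow_divisor); F - G (det - 1) is then a lift in the kernel of
    delta. *)

(** * Derivations of polynomial rings along a morphism *)

Section PolynomialDerivations.
Variables (R : comNzRingType) (m : nat).

Lemma mpoly_alg_ind (P : {mpoly R[m]} -> Prop) :
    (forall c, P c%:MP) -> (forall i, P 'X_i) ->
    (forall p q, P p -> P q -> P (p + q)) ->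
    (forall p q, P p -> P q -> P (p * q)) ->
  forall p, P p.
Proof.
move=> PC PX PD PM; have P1 : P 1 by rewrite -mpolyC1.
elim/mpolyind => [|c mm p _ _ Pp]; first by rewrite -mpolyC0.
apply: PD => //; rewrite -mul_mpolyC; apply: (PM) => //.
rewrite mpolyXE_id; apply: (big_ind P P1 PM) => i _.
by elim: (mm i) => [|k IH]; rewrite ?expr0 // exprS; apply: PM.
Qed.

Lemma eq_mpoly_rmorph (B : nzRingType) (phi psi : {rmorphism {mpoly R[m]} -> B}) :
    (forall c, phi c%:MP = psi c%:MP) -> (forall i, phi 'X_i = psi 'X_i) ->
  phi =1 psi.
Proof.
move=> eqC eqX p; elim/mpoly_alg_ind: p => // p q IHp IHq.
  by rewrite !rmorphD IHp IHq.
by rewrite !rmorphM IHp IHq.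
Qed.

(** Both sides are derivations along phi, so it is enough to compare them on the
    variables. *)
Lemma chain_rule (B : comNzRingType) (phi : {rmorphism {mpoly R[m]} -> B})
    (D : {mpoly R[m]} -> B) :
    (forall p q, D (p + q) = D p + D q) ->
    (forall p q, D (p * q) = D p * phi q + phi p * D q) ->
    (forall c, D c%:MP = 0) ->
  forall p, D p = \sum_(i < m) phi p^`M(i) * D 'X_i.
Proof.
move=> DD DM DC p; elim/mpoly_alg_ind: p => [c|j|p q IHp IHq|p q IHp IHq].
- by rewrite DC big1 // => i _; rewrite mderivC rmorph0 mul0r.
- rewrite (bigD1 j) //= big1 ?addr0 => [|i /negPf ij].
    by rewrite mderivX mnm1E eqxx scale1r -[X in (X - _)%MM]add0m addmK mpolyX0
      rmorph1 mul1r.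
  by rewrite mderivX mnm1E eq_sym ij scale0r rmorph0 mul0r.
- rewrite DD IHp IHq -big_split; apply: eq_bigr => i _ /=.
  by rewrite mderivD rmorphD mulrDl.
- rewrite DM IHp IHq mulr_suml mulr_sumr -big_split; apply: eq_bigr => i _ /=.
  by rewrite mderivM rmorphD !rmorphM; ring.
Qed.

End PolynomialDerivations.

(** * Principal minors and the coefficients of det (1 + l A) *)

Section PrincipalMinors.
Variables (R : comNzRingType) (n : nat).
Implicit Types (A : 'M[R]_n) (I : {set 'I_n}).

Definition principal_minor A I : R :=
  \det (mxsub (@enum_val _ (mem I)) (@enum_val _ (mem I)) A).

(** Listing the indices of I before the others makes the matrix on the right
    block triangular, with the minor and an identity matrix on the diagonal.
    Unlike the minor, this determinant has a size that does not depend on I. *)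
Lemma principal_minorE A I :
  principal_minor A I =
    \det (\matrix_(i, j) (if i \in I then A i j else (i == j)%:R)).
Proof.
have eIC : n = (#|I| + #|~: I|)%N by rewrite cardsC card_ord.
pose f (i : 'I_(#|I| + #|~: I|)) : 'I_n :=
  match split i with inl j => @enum_val _ (mem I) j
                   | inr j => @enum_val _ (mem (~: I)) j end.
have f_inj : injective f.
  move=> i j; rewrite /f; case: split_ordP => i' ->; case: split_ordP => j' ->.
  - by move/enum_val_inj ->.
  - by move=> e; have := enum_valP j'; rewrite inE -e enum_valP.
  - by move=> e; have := enum_valP i'; rewrite inE e enum_valP.
  - by move/enum_val_inj ->.
rewrite -(det_mxsub_bij eIC _ f_inj) -[mxsub f f _]submxK.
set B := mxsub f f _.
have -> : ulsubmx B = mxsub (@enum_val _ (mem I)) (@enum_val _ (mem I)) A.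
  by apply/matrixP => i j; rewrite !mxE /f !(unsplitK (inl _)) enum_valP.
have -> : dlsubmx B = 0.
  apply/matrixP => i j; rewrite !mxE /f (unsplitK (inl _)) (unsplitK (inr _)).
  have := enum_valP i; rewrite inE => /negPf ->.
  by case: eqP => // e; have := enum_valP i; rewrite inE e enum_valP.
have -> : drsubmx B = 1%:M.
  apply/matrixP => i j; rewrite !mxE /f !(unsplitK (inr _)).
  have := enum_valP i; rewrite inE => /negPf ->.
  by rewrite (inj_eq enum_val_inj).
by rewrite det_ublock det1 mulr1.
Qed.

(** Expanding each factor of the Leibniz formula as an entry of l A plus an entry
    of the identity gives one term for each set I of rows taken from l A. *)
Lemma det_add1Z A (l : R) :
  \det (1%:M + l *: A) =
    \sum_(k < n.+1) l ^+ k * \sum_(I : {set 'I_n} | #|I| == k) principal_minor A I.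
Proof.
transitivity (\sum_(I : {set 'I_n}) l ^+ #|I| * principal_minor A I).
  under [RHS]eq_bigr do rewrite principal_minorE mulr_sumr.
  rewrite exchange_big; apply: eq_bigr => s _ /=.
  transitivity ((-1) ^+ s * \prod_i (l * A i (s i) + (i == s i)%:R)).
    by congr (_ * _); apply: eq_bigr => i _; rewrite !mxE addrC.
  rewrite bigA_distr mulr_sumr; apply: eq_bigr => I _.
  rewrite mulrCA -prodr_const [in RHS]big_mkcond -big_split; congr (_ * _).
  by apply: eq_bigr => i _ /=; rewrite !mxE; case: ifP => _; rewrite ?mul1r.
rewrite (partition_big (fun I : {set 'I_n} => inord #|I| : 'I_n.+1) predT) //=.
have cardI I : (#|I| < n.+1)%N by rewrite ltnS -[X in (_ <= X)%N]card_ord max_card.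
apply: eq_bigr => k _; rewrite mulr_sumr; apply: eq_big => [I|I].
  by rewrite -val_eqE /= inordK.
by move=> /eqP <-; rewrite inordK.
Qed.

Lemma principal_minor_card1 A I i : #|I| = 1%N -> i \in I ->
  principal_minor A I = A i i.
Proof.
move=> I1 Ii; rewrite -[in RHS](enum_rankK_in Ii Ii); move: (enum_rank_in Ii i).
rewrite /principal_minor; move: (@enum_val _ (mem I)); rewrite I1 => f j.
by rewrite det_mx11 mxE ord1.
Qed.

Lemma sum_principal_minor1 A :
  \sum_(I : {set 'I_n} | #|I| == 1%N) principal_minor A I = \sum_i A i i.
Proof.
rewrite big_cards1; apply: eq_bigr => i _.
by apply: principal_minor_card1; rewrite ?cards1 ?inE.
Qed.

End PrincipalMinors.

(** * Evaluation of O(M_n) at a matrix *)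

Section MatrixEvaluation.
Variables (K : fieldType) (n : nat).

Lemma sum_mxvec (B : nmodType) (F : 'I_(n * n) -> B) :
  \sum_a F a = \sum_i \sum_j F (mxvec_index i j).
Proof.
by rewrite (reindex _ (curry_mxvec_bij _ _)) pair_bigA; apply: eq_bigr => -[].
Qed.

Variables (B : comNzRingType) (iota : {rmorphism K -> B}) (M : 'M[B]_n).

(** Evaluation is kept opaque, behind its values on constants and on entries:
    otherwise unification compares evaluations by computing with matrices of
    polynomials. *)
Lemma mx_eval_subproof : {phi : {rmorphism OM K n -> B} |
  (forall c, phi c%:MP = iota c) /\ (forall i j, phi (xM K i j) = M i j)}.
Proof.
exists (mmap iota (mxvec M 0)); split=> [c|i j] /=; first exact: mmapC.
by rewrite mmapX mmap1U mxvecE.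
Qed.

Definition mx_eval : {rmorphism OM K n -> B} := sval mx_eval_subproof.

Lemma mx_evalC c : mx_eval c%:MP = iota c.
Proof. exact: (svalP mx_eval_subproof).1. Qed.

Lemma mx_eval_var i j : mx_eval (xM K i j) = M i j.
Proof. exact: (svalP mx_eval_subproof).2. Qed.

Lemma map_xmat_eval : map_mx mx_eval (xmat K n) = M.
Proof. by apply/matrixP => i j; rewrite 2!mxE mx_eval_var. Qed.

Lemma eq_OM_rmorph (phi psi : {rmorphism OM K n -> B}) :
    (forall c, phi c%:MP = psi c%:MP) ->
    (forall i j, phi (xM K i j) = psi (xM K i j)) ->
  phi =1 psi.
Proof.
move=> eqC eqX; apply: eq_mpoly_rmorph => // a.
by have [i j] := mxvec_indexP a; apply: eqX.
Qed.

End MatrixEvaluation.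

(** * The Hamiltonian derivation of the trace and its Lax form *)

Section TraceFlow.
Variables (K : fieldType) (n : nat).
Local Notation xM := (xM K (n:=n)).
Local Notation xmat := (xmat K n).
Local Notation detM := (Defs.detM K n).

Definition sgn_ord (i j : 'I_n) : K := (i < j)%N%:R - (j < i)%N%:R.

Lemma sgn_ordC i j : sgn_ord i j = - sgn_ord j i.
Proof. by rewrite /sgn_ord opprB. Qed.

Lemma sgn_ordii i : sgn_ord i i = 0.
Proof. by rewrite /sgn_ord ltnn subrr. Qed.

Lemma cME k : cM K n k = \sum_(I : {set 'I_n} | #|I| == k) principal_minor xmat I.
Proof. by []. Qed.

Lemma cM1E : cM K n 1 = \sum_i xM i i.
Proof. by rewrite cME sum_principal_minor1; apply: eq_bigr => i _; rewrite mxE. Qed.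

Definition trace_flow (f : OM K n) : OM K n := sc_bracket K n (cM K n 1) f.

Lemma trace_flowD f g : trace_flow (f + g) = trace_flow f + trace_flow g.
Proof. exact: pbrDr. Qed.

Lemma trace_flowM f g : trace_flow (f * g) = trace_flow f * g + f * trace_flow g.
Proof. exact: pbr_leibniz. Qed.

Lemma trace_flowC c : trace_flow c%:MP = 0.
Proof.
by rewrite -[c%:MP]mulr1 mul_mpolyC [LHS]pbrZr pbr1r scaler0.
Qed.

Lemma trace_flow_var i j : trace_flow (xM i j) =
  \sum_k (sgn_ord k i + sgn_ord k j)%:MP * (xM i k * xM k j).
Proof.
rewrite /trace_flow pbr_anti cM1E (big_morph _ (pbrDr _ _) (pbr0r _ _)) -sumrN.
apply: eq_bigr => k _; rewrite -pbr_anti [LHS]sc_op_var sc_genE -mul_mpolyC.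
by rewrite [xM k j * _]mulrC.
Qed.

(** The strictly upper triangular part of the generic matrix minus its strictly
    lower triangular part. *)
Definition lax_mx : 'M[OM K n]_n := \matrix_(i, j) ((sgn_ord i j)%:MP * xM i j).

Lemma trace_flow_lax i j :
  trace_flow (xM i j) = (xmat *m lax_mx - lax_mx *m xmat) i j.
Proof.
rewrite trace_flow_var !mxE -sumrB; apply: eq_bigr => k _.
by rewrite !mxE (sgn_ordC k i) mpolyCD mpolyCN; ring.
Qed.

Lemma trace_flow_chain (B : comNzRingType) (phi : {rmorphism OM K n -> B}) f :
  phi (trace_flow f) = \sum_a phi f^`M(a) * phi (trace_flow 'X_a).
Proof.
apply: (chain_rule (D := fun f => phi (trace_flow f))) => [p q|p q|c].
- by rewrite trace_flowD rmorphD.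
- by rewrite trace_flowM rmorphD !rmorphM.
- by rewrite trace_flowC rmorph0.
Qed.

(** The sum is the trace of adj Y * [Y, P], which is zero because Y commutes with
    its adjugate. It is also the derivative of det at Y in the direction
    [Y, P], by Jacobi's formula. *)
Lemma tr_adj_commutator (B : comNzRingType) (Y P : 'M[B]_n) :
  \sum_i \sum_j cofactor Y i j * (Y *m P - P *m Y) i j = 0.
Proof.
transitivity (\tr (\adj Y *m (Y *m P - P *m Y))).
  rewrite exchange_big; apply: eq_bigr => j _ /=; rewrite mxE.
  by apply: eq_bigr => i _; rewrite [in RHS]mxE.
rewrite mulmxBr raddfB /= mulmxA mul_adj_mx [X in _ - X]mxtrace_mulC -mulmxA.
by rewrite mul_mx_adj scalar_mxC subrr.
Qed.

(** The matrix Y = 1 + l X satisfies the same Lax equation as X, so the derivative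
    of det Y is the sum in tr_adj_commutator. *)
Lemma trace_flow_det (l : K) : trace_flow (\det (1%:M + l%:MP *: xmat)) = 0.
Proof.
set Y := 1%:M + _.
pose sigma := mx_eval (@mpolyC _ K) Y.
have smat : map_mx sigma xmat = Y := map_xmat_eval _ _.
have detY : \det Y = sigma detM by rewrite -det_map_mx smat.
transitivity (\sum_a sigma detM^`M(a) * (trace_flow \o sigma) 'X_a).
  rewrite detY; apply: (chain_rule (D := trace_flow \o sigma)) => [p q|p q|c] /=.
  - by rewrite rmorphD trace_flowD.
  - by rewrite rmorphM trace_flowM.
  - by rewrite mx_evalC trace_flowC.
rewrite sum_mxvec -[RHS](tr_adj_commutator Y lax_mx); apply: eq_bigr => i _.
apply: eq_bigr => j _; congr (_ * _).
  by rewrite (mderiv_det K (i, j)) -smat cofactor_map_mx.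
rewrite /= mx_eval_var /Y mulmxDl mulmxDr mul1mx mulmx1 opprD addrACA subrr.
rewrite add0r -scalemxAl -scalemxAr -scalerBr [RHS]mxE -trace_flow_lax !mxE.
by rewrite trace_flowD trace_flowM trace_flowC mul0r add0r -mpolyC_nat trace_flowC add0r.
Qed.

End TraceFlow.

Section TraceFlowCharPoly.
Variables (K : numFieldType) (n : nat).

(** In a polynomial identity in l valid for infinitely many scalars l, the
    coefficients can be compared. *)
Lemma trace_flow_cM k : (k <= n)%N -> trace_flow (cM K n k) = 0.
Proof.
move=> kn; pose p : {poly OM K n} := \poly_(i < n.+1) trace_flow (cM K n i).
suff p0 : p = 0.
  by have := congr1 (fun q : {poly _} => q`_k) p0; rewrite coef_poly ltnS kn coef0.
pose rs : seq (OM K n) := [seq j%:R%:MP | j <- iota 0 n.+1].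
apply: (@roots_geq_poly_eq0 _ _ rs); last by rewrite size_map size_iota size_poly.
- apply/allP => _ /mapP[j _ ->]; apply/eqP; rewrite horner_poly.
  rewrite -[RHS](trace_flow_det n (j%:R : K)) det_add1Z.
  rewrite /trace_flow (big_morph _ (pbrDr _ _) (pbr0r _ _)); apply: eq_bigr => i _.
  by rewrite -rmorphXn mul_mpolyC pbrZr mulrC mul_mpolyC.
- rewrite map_inj_uniq ?iota_uniq // => a b /eqP.
  by rewrite mpolyC_eq Num.Theory.eqr_nat => /eqP.
Qed.

End TraceFlowCharPoly.

(** * Linearization of a derivation at a zero *)

Section LinearPart.
Variables (R : comNzRingType) (m : nat).
Implicit Types (g : {mpoly R[m]}) (u : 'X_{1..m}).

Lemma mcoeff_euler g a u : ('X_a * g^`M(a))@_u = g@_u *+ u a.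
Proof.
case: (posnP (u a)) => [ua0|ua_gt0].
  rewrite ua0 mulr0n mcoeffM big1 // => -[k1 k2] /= /eqP uE.
  rewrite mcoeffX; case: eqP => [k1E|_]; last by rewrite mul0r.
  by have := congr1 (fun w : 'X_{1..m} => w a) uE; rewrite ua0 -k1E mnmDE mnm1E eqxx.
have uE : u = (U_(a) + (u - U_(a)))%MM.
  by rewrite addmC submK //; apply/mnm_lepP => i; rewrite mnm1E; case: eqP => // <-.
rewrite {1}uE mulrC mcoeffMX mcoeff_mderiv addmC -uE mnmBE mnm1E eqxx.
by rewrite subn1 prednK.
Qed.

(** The derivation on the left sends 'X_a to lam a times 'X_a, up to terms r a of
    order at least 2. On the part of lowest degree of g it acts through its
    diagonal linear part, as the terms r a raise degrees. *)
Lemma mcoeff_linear_part (r : 'I_m -> {mpoly R[m]}) (lam : 'I_m -> nat) g u :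
    (forall a w, (mdeg w < 2)%N -> (r a)@_w = 0) ->
    (forall w, (mdeg w < mdeg u)%N -> g@_w = 0) ->
  (\sum_a ('X_a *+ lam a + r a) * g^`M(a))@_u = g@_u *+ (\sum_a lam a * u a).
Proof.
move=> r_ord2 g_low; rewrite raddf_sum -sumrMnr; apply: eq_bigr => a _ /=.
rewrite mulrDl mcoeffD mulrnAl mcoeffMn mcoeff_euler -mulrnA mulnC.
rewrite [X in _ + X]mcoeffM big1 ?addr0 // => -[k1 k2] /= /eqP uE.
have [k1_small|k1_big] := ltnP (mdeg k1) 2; first by rewrite r_ord2 ?mul0r.
rewrite mcoeff_mderiv g_low ?mul0rn ?mulr0 //.
have := congr1 (fun w => mdeg w) uE; rewrite !mdegD mdeg1; lia.
Qed.

End LinearPart.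

(** * Restriction to the diagonal and translation by a matrix *)

Section DiagonalRestriction.
Variables (K : fieldType) (n : nat).
Local Notation xM := (xM K (n:=n)).

Definition diag_restr : {rmorphism OM K n -> {mpoly K[n]}} :=
  mx_eval (@mpolyC n K) (diag_mx (\row_i 'X_i)).

Lemma diag_restrC c : diag_restr c%:MP = c%:MP.
Proof. exact: mx_evalC. Qed.

Lemma diag_restr_var i j : diag_restr (xM i j) = 'X_i *+ (i == j).
Proof. by rewrite /diag_restr mx_eval_var !mxE. Qed.

(** The coefficients of tau f are those of the Taylor expansion of f at - c. *)
Lemma translation_exists (c : 'M[K]_n) : exists tau : {rmorphism OM K n -> OM K n},
  [/\ forall a, tau a%:MP = a%:MP, forall i j, tau (xM i j) = xM i j - (c i j)%:MP,
      injective tau & forall f a, (tau f)^`M(a) = tau f^`M(a)].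
Proof.
have [tau [tauC tauX]] :=
  mx_eval_subproof (@mpolyC _ K) (xmat K n - map_mx (@mpolyC _ K) c).
have [rho [rhoC rhoX]] :=
  mx_eval_subproof (@mpolyC _ K) (xmat K n + map_mx (@mpolyC _ K) c).
have {}tauX i j : tau (xM i j) = xM i j - (c i j)%:MP by rewrite tauX !mxE.
have {}rhoX i j : rho (xM i j) = xM i j + (c i j)%:MP by rewrite rhoX !mxE.
exists tau; split=> // [|f a].
  have e : (rho \o tau : {rmorphism _ -> _}) =1 (idfun : {rmorphism _ -> _}).
    apply: eq_OM_rmorph => [d|i j] /=; first by rewrite tauC rhoC.
    by rewrite tauX raddfB /= rhoC rhoX addrK.
  by apply: (can_inj (g := rho)) => p; exact: e p.
have dX b : (tau 'X_b)^`M(a) = ('X_b)^`M(a).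
  by have [i j] := mxvec_indexP b; rewrite -/(xM i j) tauX mderivB mderivC subr0.
transitivity (\sum_b tau f^`M(b) * (tau 'X_b)^`M(a)).
  apply: (chain_rule (D := fun p => (tau p)^`M(a))) => [p q|p q|d].
  - by rewrite rmorphD mderivD.
  - by rewrite rmorphM mderivM.
  - by rewrite tauC mderivC.
rewrite (bigD1 a) //= big1 ?addr0 => [|b /negPf ba]; rewrite dX mderivX mnm1E.
  by rewrite eqxx scale1r -[X in (X - _)%MM]add0m addmK mpolyX0 mulr1.
by rewrite ba scale0r mulr0.
Qed.

Definition diag_mnm (u : 'X_{1..(n * n)}) : bool :=
  [forall i, forall j, (i != j) ==> (u (mxvec_index i j) == 0%N)].

Lemma mcoeff_kill_off (phi : {rmorphism OM K n -> OM K n}) f u :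
    (forall c, phi c%:MP = c%:MP) -> (forall i j, phi (xM i j) = xM i j *+ (i == j)) ->
  diag_mnm u -> (phi f)@_u = f@_u.
Proof.
move=> phiC phiX /forallP du.
elim/mpolyind: f => [|c w f _ _ IH]; first by rewrite rmorph0.
rewrite rmorphD !mcoeffD IH -mul_mpolyC rmorphM phiC !mul_mpolyC !mcoeffZ.
congr (_ * _ + _); rewrite [in LHS]mpolyXE_id rmorph_prod /=.
case: (boolP (diag_mnm w)) => [/forallP dw|].
  congr (_@_u); rewrite mpolyXE_id; apply: eq_bigr => a _; have [i j] := mxvec_indexP a.
  rewrite rmorphXn phiX /=.
  have := forallP (dw i) j; case: (i =P j) => [//|_] /= /eqP ->.
  by rewrite !expr0.
move=> /forallPn[i /forallPn[j]].
rewrite negb_imply => /andP[ij w0].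
rewrite (bigD1 (mxvec_index i j)) //= rmorphXn phiX (negPf ij) mulr0n.
rewrite expr0n (negPf w0) mul0r mcoeff0 mcoeffX; case: eqP => // wu.
by have := forallP (du i) j; rewrite ij -wu (negPf w0).
Qed.

(** A translation along the diagonal preserves the functions that vanish on the
    diagonal, and these have no monomial in the diagonal variables alone. *)
Lemma mcoeff_translate (c : 'I_n -> K) (tau : {rmorphism OM K n -> OM K n}) f u :
    (forall a, tau a%:MP = a%:MP) ->
    (forall i j, tau (xM i j) = xM i j - (c i *+ (i == j))%:MP) ->
  diag_restr f = 0 -> diag_mnm u -> (tau f)@_u = 0.
Proof.
move=> tauC tauX f0 du.
have [off0 [off0C off0X]] :=
  mx_eval_subproof (@mpolyC _ K) (\matrix_(i, j) (xM i j *+ (i == j))).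
have {}off0X i j : off0 (xM i j) = xM i j *+ (i == j) by rewrite off0X mxE.
rewrite -(mcoeff_kill_off _ off0C off0X du).
pose theta : {rmorphism {mpoly K[n]} -> OM K n} :=
  mmap (@mpolyC _ K) (fun i => xM i i - (c i)%:MP).
have e : (off0 \o tau : {rmorphism _ -> _}) =1
    (theta \o diag_restr : {rmorphism _ -> _}).
  apply: eq_OM_rmorph => [d|i j] /=; first by rewrite tauC off0C diag_restrC mmapC.
  rewrite tauX raddfB /= off0C off0X diag_restr_var.
  case: eqP => [->|_]; last by rewrite !mulr0n !raddf0 addr0.
  by rewrite !mulr1n /theta /= mmapX mmap1U.
by have := e f; rewrite /= f0 raddf0 => ->; exact: mcoeff0.
Qed.

End DiagonalRestriction.

(** * Invariants of the trace flow are determined on the diagonal *)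

Section Injectivity.
Variables (K : numFieldType) (n : nat).
Local Notation xM := (xM K (n:=n)).

(** The distance between i and j: one of the truncated differences is zero. *)
Definition index_dist (i j : 'I_n) : nat := (i - j + (j - i))%N.

Lemma sgn_ord_dist i j :
  sgn_ord K j i * i%:R + sgn_ord K i j * j%:R = (index_dist i j)%:R.
Proof.
rewrite /index_dist /sgn_ord; case: (ltngtP i j) => [ij|ij|/val_inj ->].
- by rewrite (eqP (ltnW ij)) add0n natrB 1?ltnW //=; ring.
- by rewrite (eqP (ltnW ij)) addn0 natrB 1?ltnW //=; ring.
- by rewrite !subrr !mul0r subnn addr0.
Qed.

(** In coordinates centred at diag (0, -1, ..., 1 - n), the derivation has
    diagonal linear part with eigenvalues index_dist i j. *)
Lemma translate_trace_flow (tau : {rmorphism OM K n -> OM K n}) i j :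
    (forall a, tau a%:MP = a%:MP) ->
    (forall i j, tau (xM i j) = xM i j - ((val i)%:R *+ (i == j))%:MP) ->
  tau (trace_flow (xM i j)) =
    'X_(mxvec_index i j) *+ index_dist i j
    + \sum_k (sgn_ord K k i + sgn_ord K k j)%:MP * (xM i k * xM k j).
Proof.
move=> tauC tauX.
pose s k := sgn_ord K k i + sgn_ord K k j.
have tauE k : tau ((s k)%:MP * (xM i k * xM k j)) = (s k)%:MP * (xM i k * xM k j)
    + ((if k == i then (sgn_ord K j i * i%:R)%:MP * xM i j else 0)
       + (if k == j then (sgn_ord K i j * j%:R)%:MP * xM i j else 0)).
  rewrite rmorphM tauC rmorphM !tauX [i == k]eq_sym.
  have expand (c a b x y : OM K n) : c * ((x - a) * (y - b)) =
    c * (x * y) + ((- (c * a)) * y + (- (c * b)) * x + (c * a) * b) by ring.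
  rewrite expand; congr (_ + _).
  case: (k =P i) => [->|_]; last first.
    case: (k =P j) => [->|_]; last first.
      by rewrite !mulr0n raddf0 !(mulr0, oppr0, mul0r, addr0).
    rewrite !mulr0n raddf0 mulr1n !(mulr0, oppr0, mul0r, addr0, add0r).
    by rewrite -mpolyCM -mpolyCN /s sgn_ordii addr0 -mulNr (sgn_ordC _ i j).
  rewrite mulr1n; case: (i =P j) => [ij|_].
    by rewrite /s -ij sgn_ordii addr0 !mul0r !raddf0 !(mul0r, oppr0, addr0).
  rewrite !mulr0n raddf0 !(mulr0, oppr0, mul0r, addr0) -mpolyCM -mpolyCN.
  by rewrite /s sgn_ordii add0r -mulNr (sgn_ordC _ j i).
rewrite trace_flow_var raddf_sum (eq_bigr _ (fun k _ => tauE k)) !big_split /=.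
rewrite -!big_mkcond !big_pred1_eq addrC -mulrDl -mpolyCD sgn_ord_dist.
by rewrite mpolyC_nat mulr_natl.
Qed.

(** In coordinates centred at diag (0, -1, ..., 1 - n), a monomial u of lowest
    degree in f would satisfy sum |i - j| u_ij = 0, hence contain diagonal
    variables only; but the coefficients of such monomials are zero, because f
    vanishes on the diagonal. *)
Lemma trace_flow_injective f : trace_flow f = 0 -> diag_restr K n f = 0 -> f = 0.
Proof.
move=> flow0 diag0.
have [tau [tauC tauX tauI tauD]] :=
  translation_exists (\matrix_(i, j) ((val i)%:R *+ (i == j)) : 'M[K]_n).
have {}tauX i j : tau (xM i j) = xM i j - ((val i)%:R *+ (i == j))%:MP.
  by rewrite tauX mxE.
pose lam (a : 'I_(n * n)) := mxvec (\matrix_(i, j) index_dist i j) 0 a.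
pose r (a : 'I_(n * n)) := tau (trace_flow 'X_a) - 'X_a *+ lam a.
have r_ord2 a w : (mdeg w < 2)%N -> (r a)@_w = 0.
  move=> w_small; rewrite /r /lam; have [i j] := mxvec_indexP a.
  rewrite mxvecE mxE -[X in trace_flow X]/(xM i j) translate_trace_flow //.
  rewrite addrAC subrr add0r raddf_sum big1 //= => k _.
  rewrite mul_mpolyC mcoeffZ /xM /Defs.xM -mpolyXD mcoeffX; case: eqP => [uw|_].
    by move: w_small; rewrite -uw mdegD !mdeg1.
  by rewrite mulr0.
have euler u : (forall w, (mdeg w < mdeg u)%N -> (tau f)@_w = 0) ->
    (tau f)@_u *+ (\sum_a lam a * u a) = 0.
  move=> low; rewrite -(mcoeff_linear_part lam r_ord2 low).
  transitivity (tau (trace_flow f))@_u; last by rewrite flow0 rmorph0 mcoeff0.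
  rewrite trace_flow_chain; congr (_@_u); apply: eq_bigr => a _.
  by rewrite /r addrC subrK tauD mulrC.
apply: tauI; rewrite rmorph0; apply/mpolyP => u; rewrite mcoeff0.
have [d] := ubnP (mdeg u); elim: d u => // d IH u ud.
have low w : (mdeg w < mdeg u)%N -> (tau f)@_w = 0.
  by move=> wu; apply: IH; apply: leq_trans wu _.
case: (boolP (diag_mnm u)) => [du|].
  exact: (mcoeff_translate (c := fun i : 'I_n => (val i)%:R) tauC tauX diag0 du).
move=> /forallPn[i /forallPn[j]]; rewrite negb_imply => /andP[ij uij].
move/eqP: (euler u low); rewrite Num.Theory.mulrn_eq0 => /orP[|/eqP//].
rewrite sum_nat_eq0 => /forallP/(_ (mxvec_index i j)) /=.
rewrite muln_eq0 (negPf uij) orbF /lam mxvecE mxE /index_dist.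
by rewrite addn_eq0 !subn_eq0 -eqn_leq (inj_eq val_inj) (negPf ij).
Qed.

End Injectivity.

(** * Invariants of the trace flow are symmetric on the diagonal *)

Section BlockFlow.
Variables (K : fieldType) (n : nat) (B : comNzRingType).
Variables (p q : 'I_n) (a b c d : B) (t : 'I_n -> B).
Hypothesis pq : (p < q)%N.

(** Diagonal, except for a 2 x 2 block on the rows and columns p and q, which
    need not be adjacent. *)
Definition block_mx2 (diag : 'I_n -> B) (xpp xpq xqp xqq : B) : 'M[B]_n :=
  \matrix_(i, j)
    if i == p then if j == p then xpp else if j == q then xpq else 0
    else if i == q then if j == p then xqp else if j == q then xqq else 0
    else diag i *+ (i == j).

Lemma block_mx2_rmorph (B' : comNzRingType) (psi : {rmorphism B -> B'}) i j :
  psi (block_mx2 t a b c d i j) =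
    (\matrix_(i, j)
      if i == p then if j == p then psi a else if j == q then psi b else 0
      else if i == q then if j == p then psi c else if j == q then psi d else 0
      else psi (t i) *+ (i == j)) i j.
Proof. by rewrite !mxE; do 4?case: ifP => _; rewrite ?rmorph0 ?rmorphMn. Qed.

(** The flow is tangent to the variety of these matrices, where it reduces to the
    flow for n = 2. *)
Lemma trace_flow_block (phi : {rmorphism OM K n -> B}) i j :
    (forall i j, phi (xM K i j) = block_mx2 t a b c d i j) ->
  phi (trace_flow (xM K i j)) =
    block_mx2 (fun=> 0) (- (2%:R * (b * c))) (b * (a - d)) (c * (a - d))
      (2%:R * (b * c)) i j.
Proof.
move=> phiX.
have qp : (q == p) = false by rewrite -(inj_eq val_inj) gtn_eqF.
have sgpq : sgn_ord K p q = 1 by rewrite /sgn_ord pq ltnNge (ltnW pq) subr0.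
have sgqp : sgn_ord K q p = -1 by rewrite sgn_ordC sgpq.
have -> : phi (trace_flow (xM K i j)) =
    \sum_k phi (sgn_ord K k i + sgn_ord K k j)%:MP *
      (block_mx2 t a b c d i k * block_mx2 t a b c d k j).
  rewrite trace_flow_var raddf_sum; apply: eq_bigr => k _ /=.
  by rewrite rmorphM rmorphM !phiX.
have [ipq|] := boolP ((i == p) || (i == q)); last first.
  rewrite negb_or => /andP[/negPf ip /negPf iq].
  rewrite big1 => [|k _]; first by rewrite !mxE ip iq mul0rn.
  rewrite !mxE ip iq; case: (i =P k) => [<-|_]; last by rewrite mulr0n mul0r mulr0.
  rewrite ip iq; case: (i =P j) => [<-|_]; last by rewrite mulr0n !mulr0.
  by rewrite sgn_ordii addr0 !raddf0 mul0r.
rewrite (bigD1 p) //= (bigD1 q) /= ?qp // big1 ?addr0; last first.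
  move=> k /andP[/negPf kp /negPf kq]; rewrite !mxE kp kq.
  by case/orP: ipq => /eqP ->; rewrite ?eqxx ?qp mul0r mulr0.
have [jpq|] := boolP ((j == p) || (j == q)); last first.
  rewrite negb_or => /andP[/negPf jp /negPf jq].
  rewrite !mxE eqxx qp eqxx jp jq !mulr0 addr0.
  by case/orP: ipq => /eqP ->; rewrite ?eqxx ?qp.
have phi2 : phi (1 + 1)%:MP = 2%:R by rewrite !rmorphD !rmorph1.
have phiN2 : phi (- 1 - 1)%:MP = - 2%:R by rewrite -opprD !rmorphN phi2.
have phi1 : phi 1%:MP = 1 by rewrite !rmorph1.
have phiN1 : phi (-1)%:MP = -1 by rewrite !rmorphN phi1.
have phi0 : phi 0%:MP = 0 by rewrite !raddf0.
by case/orP: ipq => /eqP ->; case/orP: jpq => /eqP ->;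
  rewrite !mxE !(eqxx, qp) !sgn_ordii ?sgpq ?sgqp ?add0r ?addr0 ?phi2 ?phiN2 ?phi1
    ?phiN1 ?phi0; ring.
Qed.

End BlockFlow.

Section BlockEuler.
Variables (K : fieldType) (n : nat) (B : comNzRingType) (E : B -> B).
Hypothesis ED : forall x y, E (x + y) = E x + E y.
Hypothesis EM : forall x y, E (x * y) = E x * y + x * E y.
Variables (p q : 'I_n) (s Z W : B) (t : 'I_n -> B).
Hypothesis pq : (p < q)%N.
Hypotheses (Es : E s = 0) (EZ : E Z = Z) (EW : E W = - W) (Et : forall i, E (t i) = 0).

(** With a - d = 2 (Z + W) and c = - b = Z - W, the invariant (a - d)^2 + 4 b c of
    the flow is 16 Z W. The Euler derivation E has the same invariant, and
    indeed it is proportional to the flow on this family of blocks. *)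
Lemma trace_flow_euler (phi : {rmorphism OM K n -> B}) f :
    (forall c, E (phi c%:MP) = 0) ->
    (forall i j, phi (xM K i j) =
       block_mx2 p q t (s + (Z + W)) (W - Z) (Z - W) (s - (Z + W)) i j) ->
  phi (trace_flow f) = (Z - W) *+ 2 * E (phi f).
Proof.
move=> phiC phiX.
have E0 : E 0 = 0 by apply: (addrI (E 0)); rewrite -ED !addr0.
have EN x : E (- x) = - E x by apply/eqP; rewrite -addr_eq0 -ED addNr E0.
rewrite trace_flow_chain.
have -> : E (phi f) = \sum_a phi f^`M(a) * E (phi 'X_a).
  apply: (chain_rule (D := fun f => E (phi f))) => [g h|g h|c] //.
    by rewrite rmorphD ED.
  by rewrite rmorphM EM.
rewrite mulr_sumr; apply: eq_bigr => a _; rewrite mulrCA; congr (_ * _).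
have [i j] := mxvec_indexP a.
rewrite -/(xM K i j) (trace_flow_block pq _ _ phiX) phiX !mxE.
have Etm k b : E (t k *+ b) = 0.
  by elim: b => [|b IH]; rewrite ?mulrS ?ED ?Et ?IH ?addr0.
case: (i == p); case: (j == p); case: (i == q); case: (j == q) => /=;
  rewrite ?mul0rn ?(Etm, E0, ED, EN, EZ, EW, Es); ring.
Qed.

End BlockEuler.

Lemma mpoly_cancel (R : idomainType) m (u v : {mpoly R[m]}) :
  u != 0 -> u * v = 0 -> v = 0.
Proof. by move=> u0 /eqP; rewrite mulf_eq0 (negPf u0) => /eqP. Qed.

Section Symmetry.
Variables (K : numFieldType) (n : nat).
Local Notation L := {mpoly K[n]}.

Lemma mpoly_mulrIn (x : L) : x != 0 -> injective (GRing.natmul x).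
Proof.
rewrite -mleadc_eq0 => x0 j k /(congr1 (mcoeff (mlead x))).
by rewrite !mcoeffMn; apply: Num.Theory.mulrIn.
Qed.

(** The coefficients are polynomials: they contain the trace of the block and the
    diagonal entries outside of it as independent parameters. *)
Definition euler2 (F : {mpoly L[2]}) : {mpoly L[2]} :=
  'X_0 * F^`M(0) - 'X_1 * F^`M(1).

Lemma euler2D F G : euler2 (F + G) = euler2 F + euler2 G.
Proof. by rewrite /euler2 !mderivD !mulrDr opprD addrACA. Qed.

Lemma euler2M F G : euler2 (F * G) = euler2 F * G + F * euler2 G.
Proof.
rewrite /euler2 !mderivM; move: F^`M(0) G^`M(0) F^`M(1) G^`M(1) 'X_0 'X_1.
have aux (R : comNzRingType) (f g f0 g0 f1 g1 x y : R) :
  x * (f0 * g + f * g0) - y * (f1 * g + f * g1) =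
  (x * f0 - y * f1) * g + f * (x * g0 - y * g1) by ring.
by move=> *; apply: aux.
Qed.

Lemma euler2C c : euler2 c%:MP = 0.
Proof. by rewrite /euler2 !mderivC !mulr0 subrr. Qed.

Lemma euler2_X0 : euler2 'X_0 = 'X_0.
Proof.
rewrite /euler2 !mderivX !mnm1E /= scale0r mulr0 subr0 scale1r.
by rewrite -[X in (X - _)%MM]add0m addmK mpolyX0 mulr1.
Qed.

Lemma euler2_X1 : euler2 'X_1 = - 'X_1.
Proof.
rewrite /euler2 !mderivX !mnm1E /= scale0r mulr0 sub0r scale1r.
by rewrite -[X in (X - _)%MM]add0m addmK mpolyX0 mulr1.
Qed.

(** The monomials of F have the same exponent in both variables, so F is a
    polynomial in 'X_0 * 'X_1. *)
Lemma euler2_kernel (F : {mpoly L[2]}) (y : L) :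
  euler2 F = 0 -> F.@[fun=> y] = F.@[fun=> - y].
Proof.
move=> EF; rewrite !mevalE; apply: eq_big_seq => m mF; congr (_ * _).
have m01 : m 0 = m 1.
  apply: (mpoly_mulrIn (x := F@_m)); first by rewrite mcoeff_eq0 mF.
  have /(congr1 (mcoeff m)) e := subr0_eq EF.
  exact: etrans (esym (mcoeff_euler F 0 m)) (etrans e (mcoeff_euler F 1 m)).
rewrite !big_ord_recl !big_ord0 !mulr1.
have -> : lift ord0 ord0 = 1 :> 'I_2 by apply: val_inj.
by rewrite -[ord0]/(0 : 'I_2) m01 -!exprMn_comm ?mulrNN //; exact: mulrC.
Qed.

(** The points Z = W = y and Z = W = - y of the parametrization have the same value
    of Z W; their blocks are diag (s + 2 y, s - 2 y) and diag (s - 2 y, s + 2 y). *)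
Lemma diag_restr_swap (f : OM K n) (p q : 'I_n) : trace_flow f = 0 ->
  (p < q)%N -> msym (tperm p q) (diag_restr K n f) = diag_restr K n f.
Proof.
move=> flow0 pq.
have qp : (q == p) = false by rewrite -(inj_eq val_inj) gtn_eqF.
pose Z : {mpoly L[2]} := 'X_0; pose W : {mpoly L[2]} := 'X_1.
(* Chosen so that Z = W = y gives the block diag ('X_p, 'X_q). *)
pose s : L := 2^-1 *: ('X_p + 'X_q); pose y : L := 4^-1 *: ('X_p - 'X_q).
have inv4 : 4^-1 + 4^-1 = 2^-1 :> K by field.
have yy : y + y = 2^-1 *: ('X_p - 'X_q) by rewrite -scalerDl inv4.
have sy : s + (y + y) = 'X_p.
  rewrite yy -scalerDr addrCA addrK -mulr2n -scaler_nat scalerA.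
  by rewrite mulVf ?scale1r ?Num.Theory.pnatr_eq0.
have sNy : s - (y + y) = 'X_q.
  rewrite yy -scalerBr opprB addrCA ['X_p + 'X_q]addrC addrK -mulr2n.
  by rewrite -scaler_nat scalerA mulVf ?scale1r ?Num.Theory.pnatr_eq0.
have [phi [phiC phiX]] := mx_eval_subproof (@mpolyC 2 L \o @mpolyC n K)
  (block_mx2 p q (fun i => ('X_i : L)%:MP) (s%:MP + (Z + W)) (W - Z) (Z - W)
     (s%:MP - (Z + W))).
have flowE : phi (trace_flow f) = (Z - W) *+ 2 * euler2 (phi f).
  apply: (trace_flow_euler euler2D euler2M pq _ euler2_X0 euler2_X1 _ f _ phiX).
  - exact: euler2C.
  - by move=> i; exact: euler2C.
  - by move=> c; rewrite phiC; exact: euler2C.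
have ZW0 : (Z - W) *+ 2 != 0.
  apply/eqP => /(congr1 (meval (fun i : 'I_2 => (i == 0)%:R))).
  rewrite mevalMn mevalB !mevalXU meval0 /= subr0 => /eqP.
  by rewrite -mpolyC_nat mpolyC_eq0 Num.Theory.pnatr_eq0.
have prod0 : (Z - W) *+ 2 * euler2 (phi f) = 0.
  exact: etrans (esym flowE) (etrans (congr1 phi flow0) (rmorph0 phi)).
have Ephi : euler2 (phi f) = 0 := mpoly_cancel ZW0 prod0.
have evX (x : L) i j : (phi (xM K i j)).@[fun=> x] =
    block_mx2 p q (fun i => 'X_i) (s + (x + x)) 0 0 (s - (x + x)) i j.
  have e1 : (s%:MP + (Z + W)).@[fun=> x] = s + (x + x).
    by rewrite !mevalD mevalC !mevalXU.
  have e2 : (s%:MP - (Z + W)).@[fun=> x] = s - (x + x).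
    by rewrite mevalB mevalD mevalC !mevalXU.
  have e3 : (W - Z).@[fun=> x] = 0 by rewrite mevalB !mevalXU subrr.
  have e4 : (Z - W).@[fun=> x] = 0 by rewrite mevalB !mevalXU subrr.
  rewrite phiX (block_mx2_rmorph _ _ _ _ _ _ _ (meval (fun=> x))) !mxE /= e1 e2 e3 e4.
  by rewrite mevalC.
have evC (x : L) c : (phi c%:MP).@[fun=> x] = c%:MP by rewrite phiC mevalC.
have ev_y : (meval (fun=> y) \o phi : {rmorphism _ -> _}) =1 diag_restr K n.
  apply: eq_OM_rmorph => [e|i j] /=; first by rewrite evC diag_restrC.
  rewrite evX diag_restr_var !mxE sy sNy.
  have [->|ip] := eqVneq i p; first by rewrite eq_sym; case: ifP => // _; case: ifP.
  have [->|iq] := eqVneq i q; last by [].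
  rewrite [q == j]eq_sym; case: eqP => [->|_]; last by case: ifP.
  by rewrite eq_sym qp.
have ev_Ny : (meval (fun=> - y) \o phi : {rmorphism _ -> _}) =1
    (msym (tperm p q) \o diag_restr K n : {rmorphism _ -> _}).
  apply: eq_OM_rmorph => [e|i j] /=.
    by rewrite evC diag_restrC /msym mmapC.
  rewrite evX diag_restr_var !mxE -opprD sNy opprK sy rmorphMn /= /msym mmapX mmap1U.
  have [->|ip] := eqVneq i p.
    by rewrite tpermL eq_sym; case: ifP => // _; case: ifP.
  have [->|iq] := eqVneq i q; last by rewrite tpermD // eq_sym.
  rewrite tpermR [q == j]eq_sym; case: eqP => [->|_]; last by case: ifP.
  by rewrite eq_sym qp.
exact: etrans (esym (ev_Ny f)) (etrans (esym (euler2_kernel y Ephi)) (ev_y f)).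
Qed.

(** It is enough to check transpositions, as they generate the symmetric
    group. *)
Lemma diag_restr_sym (f : OM K n) : trace_flow f = 0 ->
  diag_restr K n f \is symmetric.
Proof.
move=> flow0; apply/issymP => s.
have [ts -> _] := prod_tpermP s.
elim/big_rec: _ => [|i u _ IH]; first exact: msym1m.
rewrite msymMm; case: i => p q /=.
have -> : msym (tperm p q) (diag_restr K n f) = diag_restr K n f; last exact: IH.
case: (ltngtP p q) => [pq|qp|/val_inj ->]; first exact: diag_restr_swap.
  by rewrite tpermC; apply: diag_restr_swap.
by rewrite tperm1 msym1m.
Qed.

End Symmetry.

(** * Maximality from the centralizer of one element *)

Section SubalgebraGeneration.
Variables (K : fieldType) (A : comAlgType K).
Implicit Types (S X : set A).

Lemma subalgebraP S : subalgebra S <->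
  [/\ S 1, forall c u v, S u -> S v -> S (c *: u + v)
         & forall u v, S u -> S v -> S (u * v)].
Proof.
split=> [[S1 SL SM]|[S1 SL SM]]; split.
- exact: set_mem S1.
- by move=> c u v Su Sv; apply: set_mem; apply: SL; apply: mem_set.
- by move=> u v Su Sv; apply: set_mem; apply: SM; apply: mem_set.
- exact: mem_set.
- by move=> c u v /set_mem Su /set_mem Sv; apply: mem_set; apply: SL.
- by move=> u v /set_mem Su /set_mem Sv; apply: mem_set; apply: SM.
Qed.

Lemma subalg_gen_subalgebra X : subalgebra (subalg_gen X).
Proof.
apply/subalgebraP; split=> [|c u v Xu Xv T TX|u v Xu Xv T TX].
- by move=> T [/subalgebraP[T1 _ _] _].
- by have [/subalgebraP[_ TL _] _] := TX; apply: TL; [apply: Xu|apply: Xv].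
- by have [/subalgebraP[_ _ TM] _] := TX; apply: TM; [apply: Xu|apply: Xv].
Qed.

Lemma centralizer_subalgebra (br : poisson_bracket A) z :
  subalgebra [set f | br z f = 0].
Proof.
apply/subalgebraP; split=> /= [|c u v zu zv|u v zu zv]; first exact: pbr1r.
  by rewrite pbr_linearr zu zv scaler0 addr0.
by rewrite pbr_leibniz zu zv mul0r mulr0 addr0.
Qed.

(** A Poisson-commutative T containing subalg_gen X contains z, so it lies in the
    centralizer of z, which is subalg_gen X. *)
Lemma maximal_of_centralizer (br : poisson_bracket A) X z :
    br z z = 0 -> (forall f, X f -> br z f = 0) ->
    (forall f, br z f = 0 -> subalg_gen X f) ->
    (forall f g, br z f = 0 -> br z g = 0 -> br f g = 0) ->
  maximal_poisson_commutative br (subalg_gen X).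
Proof.
move=> zz Xz zX zC.
have genz f : subalg_gen X f -> br z f = 0.
  move=> Xf; apply: (Xf [set g | br z g = 0]); split=> //.
  exact: centralizer_subalgebra.
split; [exact: subalg_gen_subalgebra|by move=> f g /genz zf /genz; exact: zC|].
move=> [T [_ Tcomm [XT nTX]]]; apply: nTX => f Tf; apply: (zX).
by apply: Tcomm => //; apply: XT; apply: zX.
Qed.

End SubalgebraGeneration.

Lemma subalg_gen_image (K : fieldType) (A B : comAlgType K) (phi : A -> B)
    (X : set A) (Y : set B) :
    phi 1 = 1 -> (forall c u v, phi (c *: u + v) = c *: phi u + phi v) ->
    (forall u v, phi (u * v) = phi u * phi v) ->
    (forall x, X x -> subalg_gen Y (phi x)) ->
  forall f, subalg_gen X f -> subalg_gen Y (phi f).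
Proof.
move=> phi1 phiL phiM XY f Xf.
have /subalgebraP[Y1 YL YM] := subalg_gen_subalgebra Y.
apply: (Xf [set g | subalg_gen Y (phi g)]); split=> //.
apply/subalgebraP; split=> /= [|c u v Yu Yv|u v Yu Yv].
- by rewrite phi1.
- by rewrite phiL; apply: YL.
- by rewrite phiM; apply: YM.
Qed.

(** * The Poisson centralizer of the trace *)

Section Centralizer.
Variables (K : numFieldType) (n : nat).
Local Notation br := (sc_bracket K n).

Lemma principal_minor_diag (R : comNzRingType) m (d : 'rV[R]_m) (I : {set 'I_m}) :
  principal_minor (diag_mx d) I = \prod_(i in I) d 0 i.
Proof.
rewrite principal_minorE big_mkcond -[RHS]/(\prod_i (if i \in I then d 0 i else 1)).
transitivity (\det (diag_mx (\row_i (if i \in I then d 0 i else 1)))).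
  congr (\det _); apply/matrixP => i j; rewrite !mxE.
  by case: eqP => _; case: ifP.
by rewrite det_diag; apply: eq_bigr => i _; rewrite mxE.
Qed.

Lemma diag_restr_cM k : diag_restr K n (cM K n k) = mesym n K k.
Proof.
rewrite cME raddf_sum; apply: eq_bigr => I _ /=.
rewrite /principal_minor -det_map_mx map_mxsub map_xmat_eval -/(principal_minor _ _).
by rewrite principal_minor_diag; apply: eq_bigr => i _; rewrite mxE.
Qed.

(** The bracket is again invariant, by the Jacobi identity, and it vanishes on the
    diagonal: {x_ij, x_kl} is a multiple of x_il x_kj, which is nonzero there only
    if i = l and k = j, and then the multiple is zero. *)
Lemma trace_flow0_commute f g : trace_flow f = 0 -> trace_flow g = 0 -> br f g = 0.
Proof.
move=> f0 g0; apply: trace_flow_injective.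
  have := pbr_jacobi br (cM K n 1) f g.
  rewrite -/(trace_flow _) [br g _]pbr_anti -/(trace_flow g) g0 oppr0 pbr0r addr0.
  by rewrite -/(trace_flow f) f0 pbr0r addr0.
rewrite [br f g]/(sc_op f g) raddf_sum big1 // => -[i j] _ /=.
rewrite raddf_sum big1 // => -[k l] _ /=; rewrite rmorphM.
rewrite sc_genE -mul_mpolyC rmorphM rmorphM !diag_restr_var diag_restrC.
case: (i =P l) => [->|_]; last by rewrite mulr0n !mul0r mulr0 mul0r.
case: (k =P j) => [->|_]; last by rewrite mulr0n !mulr0 mul0r.
by rewrite addrA subrK subrr mpolyC0 !mul0r.
Qed.

(** The restriction of f to the diagonal is a polynomial t in the elementary
    symmetric polynomials; f and t (c_1, ..., c_n) are invariants with the same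
    restriction. *)
Lemma trace_flow0_gen f : trace_flow f = 0 ->
  subalg_gen [set cM K n i | i in [set i | (1 <= i <= n)%N]] f.
Proof.
move=> f0; set X := [set _ | _ in _].
have [t [tE _]] := sym_fundamental (diag_restr_sym f0).
pose psi : {rmorphism {mpoly K[n]} -> OM K n} :=
  mmap (@mpolyC _ K) (fun i : 'I_n => cM K n i.+1).
have /subalgebraP[gen1 genL genM] := subalg_gen_subalgebra X.
have gen0 : subalg_gen X 0.
  by rewrite -[0](addNr 1) -scaleN1r; apply: genL.
have psi_gen : subalg_gen X (psi t).
  elim/mpoly_alg_ind: t {tE} => [c|i|p q IHp IHq|p q IHp IHq].
  - have -> : psi c%:MP = c *: 1 + 0 by rewrite addr0 -mul_mpolyC mulr1 /psi /= mmapC.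
    exact: genL.
  - rewrite /psi /= mmapX mmap1U; apply: (@sub_gen_smallest _ _ X).
    by exists i.+1 => //=; exact: ltn_ord.
  - by rewrite rmorphD -[psi p]scale1r; apply: genL.
  - by rewrite rmorphM; apply: genM.
suff -> : f = psi t by [].
apply/eqP; rewrite -subr_eq0; apply/eqP; apply: trace_flow_injective.
  rewrite /trace_flow pbrDr pbrNr -/(trace_flow f) f0 sub0r.
  suff -> : br (cM K n 1) (psi t) = 0 by rewrite oppr0.
  apply: (psi_gen [set g | br (cM K n 1) g = 0]); split.
    exact: centralizer_subalgebra.
  by move=> _ [i /andP[_ ilen] <-]; apply: trace_flow_cM.
rewrite rmorphB /= -tE; apply/eqP; rewrite subr_eq0; apply/eqP.
have e : (comp_mpoly [tuple mesym n K i.+1 | i < n] : {rmorphism _ -> _}) =1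
    (diag_restr K n \o psi : {rmorphism _ -> _}).
  apply: eq_mpoly_rmorph => [c|i] /=; first by rewrite comp_mpolyC mmapC diag_restrC.
  by rewrite comp_mpolyXU mmapX mmap1U diag_restr_cM -tnth_nth tnth_mktuple.
exact: e t.
Qed.

End Centralizer.

(** * Homogeneous components *)

Section HomogeneousParts.
Variables (R : comNzRingType) (m : nat).
Local Notation A := {mpoly R[m]}.
Local Notation pi d := (pihomog (mdeg (n := m)) d).

Lemma homog_mderiv d a (p : A) : p \is d.+1.-homog -> p^`M(a) \is d.-homog.
Proof.
move=> hp; apply/dhomogP => u; rewrite mcoeff_msupp mcoeff_mderiv => u_supp.
apply: contraNeq u_supp => ud.
by rewrite (dhomog_nemf_coeff hp) ?mul0rn //= mdegD mdeg1 addn1 eqSS.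
Qed.

Lemma homog_prod_linear (I : Type) (r : seq I) (F : I -> A) :
  (forall i, F i \is 1.-homog) -> \prod_(i <- r) F i \is (size r).-homog.
Proof.
move=> F1; elim: r => [|i r IH]; first by rewrite big_nil dhomog1.
by rewrite big_cons /= -add1n; apply: dhomogM.
Qed.

Lemma pihomog_shift s (T : A -> A) :
    (forall p q, T (p + q) = T p + T q) ->
    (forall d p, p \is d.-homog -> T p \is (d + s).-homog) ->
  forall d f, pi d (T f) = if (s <= d)%N then T (pi (d - s) f) else 0.
Proof.
move=> TD Ts d f.
have T0 : T 0 = 0 by apply: (addrI (T 0)); rewrite -TD !addr0.
pose N := (msize f + d.+1)%N.
rewrite {1}(@pihomog_partitionE _ _ mdeg N f) ?leq_addr //.
rewrite (big_morph T TD T0) raddf_sum /=.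
case: ifP => [sd|sd].
  have dsN : (d - s < N)%N.
    by rewrite /N; lia.
  rewrite (bigD1 (Ordinal dsN)) //= big1 ?addr0 => [|e ne].
    by apply: pihomog_dE; have := Ts _ _ (pihomogP mdeg (d - s) f); rewrite subnK.
  apply: (@pihomog_ne0 _ _ _ (e + s)%N); last by apply: Ts; apply: pihomogP.
  by move: ne; rewrite -val_eqE /=; lia.
rewrite big1 // => e _.
apply: (@pihomog_ne0 _ _ _ (e + s)%N); last by apply: Ts; apply: pihomogP.
by lia.
Qed.

End HomogeneousParts.

(** * Lifting invariants from O(SL_n) to O(M_n) *)

Section TraceFlowImage.
Variables (K : numFieldType) (n : nat).
Hypothesis n_gt0 : (0 < n)%N.
Local Notation detM := (Defs.detM K n).
Local Notation pi d := (pihomog (mdeg (n := (n * n)%N)) d).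

Lemma homog_xM (i j : 'I_n) : xM K i j \is 1.-homog.
Proof. by rewrite dhomogX /= mdeg1. Qed.

Lemma homog_detM : detM \is n.-homog.
Proof.
apply: rpred_sum => s _; rewrite mulr_sign.
suff h : \prod_i xmat K n i (s i) \is n.-homog by case: ifP; rewrite ?dhomogN.
rewrite -[X in X.-homog](size_enum_ord n) -[enum _]/(enum 'I_n) enumT.
by apply: homog_prod_linear => i; rewrite mxE homog_xM.
Qed.

Lemma homog_trace_flow d (f : OM K n) :
  f \is d.-homog -> trace_flow f \is (d + 1).-homog.
Proof.
rewrite -[trace_flow f]/(idfun (trace_flow f)) trace_flow_chain /=.
case: d => [|d] fd.
  have -> : f = (f@_0%MM)%:MP.
    apply/mpolyP => u; rewrite mcoeffC; case: eqP => [<-|u0]; first by rewrite mulr1.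
    by rewrite mulr0 (dhomog_nemf_coeff fd) // mdeg_eq0; apply/eqP => ?; apply: u0.
  by rewrite big1 ?rpred0 // => a _; rewrite mderivC mul0r.
apply: rpred_sum => a _.
have -> : (d.+1 + 1 = d + 2)%N by lia.
apply: dhomogM; first exact: homog_mderiv.
have [i j] := mxvec_indexP a; rewrite -[X in trace_flow X]/(xM K i j) trace_flow_var.
apply: rpred_sum => k _; rewrite mul_mpolyC; apply: dhomogZ.
by rewrite -[2%N]/(1 + 1)%N; apply: dhomogM; exact: homog_xM.
Qed.

(** In degree d the equation reads
    H_d = H_(d - n) det - delta F_(d - 1). By induction on d each H_d is in the
    image of delta, which is stable under multiplication by the central element
    det. *)
Lemma trace_flow_divisor (F H : OM K n) :
  trace_flow F = H * (detM - 1) -> exists G, H = trace_flow G.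
Proof.
move=> FH.
have im0 : exists G : OM K n, 0 = trace_flow G by exists 0; rewrite /trace_flow pbr0r.
have imD (f g : OM K n) :
    (exists G, f = trace_flow G) -> (exists G, g = trace_flow G) ->
  exists G, f + g = trace_flow G.
  by move=> [G1 ->] [G2 ->]; exists (G1 + G2); rewrite trace_flowD.
have imN (f : OM K n) : (exists G, f = trace_flow G) -> exists G, - f = trace_flow G.
  by move=> [G ->]; exists (- G); rewrite /trace_flow pbrNr.
have piH d : pi d H = pi d (H * detM) - pi d (trace_flow F).
  by rewrite FH mulrBr mulr1 raddfB /= opprB addrC subrK.
suff im_pi d : exists G, pi d H = trace_flow G.
  rewrite (@pihomog_partitionE _ _ mdeg (msize H) H) //.
  by elim/big_ind: _ => // e _; apply: im_pi.
have [N] := ubnP d; elim: N d => // N IH d dN.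
rewrite piH; apply: imD.
  rewrite (@pihomog_shift _ _ n (fun f => f * detM)); first last.
  - by move=> e p pe; apply: dhomogM => //; exact: homog_detM.
  - by move=> p q; rewrite mulrDl.
  case: ifP => // nd; have [|G ->] := IH (d - n)%N; first by lia.
  exists (G * detM); rewrite trace_flowM -cM_det trace_flow_cM // mulr0 addr0 //.
apply: imN; rewrite (@pihomog_shift _ _ 1 (@trace_flow K n)); first last.
- exact: homog_trace_flow.
- exact: trace_flowD.
by case: ifP => // _; eexists.
Qed.

End TraceFlowImage.

(** * The three maximal Poisson-commutative subalgebras *)

Section Maximality.
Variables (K : numFieldType) (n : nat).
Hypothesis n_gt0 : (0 < n)%N.
Local Notation detM := (Defs.detM K n).
Local Notation c1 := (cM K n 1).

Lemma trace_flow_detM : trace_flow detM = 0.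
Proof. by rewrite -cM_det trace_flow_cM. Qed.

Lemma maximal_OM : maximal_poisson_commutative (sc_bracket K n)
  (subalg_gen [set cM K n i | i in [set i | (1 <= i <= n)%N]]).
Proof.
apply: (@maximal_of_centralizer _ _ _ _ c1).
- exact: trace_flow_cM.
- by move=> _ [i /andP[_ ilen] <-]; apply: trace_flow_cM.
- exact: trace_flow0_gen.
- exact: trace_flow0_commute.
Qed.

(** A lift F of f satisfies {c_1, F} = H (det - 1) with H = {c_1, G}, and
    F - G (det - 1) is the required lift. *)
Lemma SL_centralizer_lift (f : OSL K n) :
  SL_bracket K n (toSL c1) f = 0 -> exists2 F, trace_flow F = 0 & f = toSL F.
Proof.
have [F ->] := toSL_surj f.
rewrite SL_bracket_toSL -(rmorph0 (@toSL K n)) => /toSL_eqP[H].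
rewrite add0r => FH; have [G HG] := trace_flow_divisor n_gt0 FH.
exists (F - G * (detM - 1)); last first.
  by apply/toSL_eqP; exists G; rewrite subrK.
rewrite /trace_flow pbrDr pbrNr pbr_leibniz pbrDr pbrNr pbr1r.
rewrite -!/(trace_flow _) trace_flow_detM [trace_flow F]FH HG.
by rewrite subr0 mulr0 addr0 subrr.
Qed.

Lemma maximal_OSL : maximal_poisson_commutative (SL_bracket K n)
  (subalg_gen [set toSL (cM K n i) | i in [set i | (1 <= i < n)%N]]).
Proof.
apply: (@maximal_of_centralizer _ _ _ _ (toSL c1)).
- by rewrite SL_bracket_toSL [sc_bracket K n _ _]trace_flow_cM // rmorph0.
- move=> _ [i /andP[_ iltn] <-].
  by rewrite SL_bracket_toSL [sc_bracket K n _ _]trace_flow_cM ?rmorph0 // ltnW.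
- move=> f /SL_centralizer_lift[F F0 ->]; move: (trace_flow0_gen F0); move: F {F0}.
  have /subalgebraP[gen1 _ _] := subalg_gen_subalgebra
    [set toSL (cM K n i) | i in [set i | (1 <= i < n)%N]].
  apply: subalg_gen_image.
  + exact: rmorph1.
  + by move=> c u v; rewrite rmorphD /= toSLZ.
  + exact: rmorphM.
  + move=> _ [i /andP[i_gt0 ilen] <-].
    move: ilen; rewrite leq_eqVlt => /orP[/eqP ->|iltn]; last first.
      by apply: sub_gen_smallest; exists i => //=; rewrite i_gt0.
    suff -> : toSL (cM K n n) = 1 by [].
    rewrite -(rmorph1 (@toSL K n)) cM_det; apply/toSL_eqP.
    by exists 1; rewrite mul1r addrC subrK.
- move=> _ _ /SL_centralizer_lift[F F0 ->] /SL_centralizer_lift[G G0 ->].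
  by rewrite SL_bracket_toSL trace_flow0_commute // rmorph0.
Qed.

Lemma GL_bracket_frac f g k l :
  GL_bracket K n (GL_frac f k) (GL_frac g l) = GL_frac (sc_bracket K n f g) (k + l).
Proof. exact: GL_op_frac. Qed.

Lemma GL_frac0 k : GL_frac (0 : OM K n) k = 0.
Proof. by rewrite -(rmorph0 (@toGL K n)); apply/GL_frac_eq; rewrite !mul0r. Qed.

Lemma toGL_cM_inv : (toGL (cM K n n))^-1 = GL_frac 1 1.
Proof.
have u : toGL (cM K n n) \is a GRing.unit by rewrite cM_det toGL_det_unit.
apply: (mulrI u); rewrite divrr // -(rmorph1 (@toGL K n)) GL_fracM.
by apply/GL_frac_eq; rewrite cM_det mulr1 mul1r add0n expr1 expr0 mulr1.
Qed.

Lemma GL_centralizer_lift (f : OGL K n) :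
  GL_bracket K n (toGL c1) f = 0 -> exists F k, trace_flow F = 0 /\ f = GL_frac F k.
Proof.
have [[F k] ->] := GL_fracP f; rewrite /= GL_bracket_frac -(GL_frac0 0).
move=> /GL_frac_eq; rewrite mul0r expr0 mulr1 => F0.
by exists F, k.
Qed.

Lemma maximal_OGL : maximal_poisson_commutative (GL_bracket K n)
  (subalg_gen ([set toGL (cM K n i) | i in [set i | (1 <= i <= n)%N]]
     `|` [set (toGL (cM K n n))^-1])).
Proof.
set X := _ `|` _.
apply: (@maximal_of_centralizer _ _ _ _ (toGL c1)).
- by rewrite GL_bracket_toGL [sc_bracket K n _ _]trace_flow_cM // rmorph0.
- move=> _ [[i /andP[_ ilen] <-]|->].
    by rewrite GL_bracket_toGL [sc_bracket K n _ _]trace_flow_cM // rmorph0.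
  by rewrite toGL_cM_inv GL_bracket_frac pbr1r GL_frac0.
- move=> _ /GL_centralizer_lift[F [k [F0 ->]]].
  have /subalgebraP[gen1 _ genM] := subalg_gen_subalgebra X.
  have -> : GL_frac F k = toGL F * ((toGL (cM K n n))^-1) ^+ k.
    elim: k => [|k IH]; first by rewrite expr0 mulr1.
    rewrite exprSr mulrA -IH toGL_cM_inv GL_fracM; apply/GL_frac_eq.
    by rewrite mulr1 addn1.
  apply: (genM); last first.
    elim: k => [|k IH]; rewrite ?expr0 // exprS; apply: (genM) => //.
    by apply: sub_gen_smallest; right.
  move: (trace_flow0_gen F0); move: F {F0}; apply: subalg_gen_image.
  + exact: rmorph1.
  + by move=> c u v; rewrite rmorphD /= [toGL (c *: u)]/toGL -GL_fracZ.
  + exact: rmorphM.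
  + by move=> _ [i i_le <-]; apply: sub_gen_smallest; left; exists i.
- move=> _ _ /GL_centralizer_lift[F [k [F0 ->]]] /GL_centralizer_lift[G [l [G0 ->]]].
  by rewrite GL_bracket_frac trace_flow0_commute // GL_frac0.
Qed.

End Maximality.

Theorem theorem1p1 (R : realType) (n : nat) (hn : (1 <= n)%N) :
  [/\ maximal_poisson_commutative (SL_bracket R[i] n)
        (subalg_gen [set toSL (cM R[i] n i) | i in [set i | (1 <= i < n)%N]]),
      maximal_poisson_commutative (sc_bracket R[i] n)
        (subalg_gen [set cM R[i] n i | i in [set i | (1 <= i <= n)%N]]) &
      maximal_poisson_commutative (GL_bracket R[i] n)
        (subalg_gen ([set toGL (cM R[i] n i) | i in [set i | (1 <= i <= n)%N]]
          `|` [set (toGL (cM R[i] n n))^-1]))].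
Proof.
split; [exact: maximal_OSL|exact: maximal_OM|exact: maximal_OGL].
Qed.
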